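(* Let $R$ be a ring, let $\mathcal{M}$ be one of the following three classes of homomorphisms of left $R$-modules: all embeddings, all $RD$-embeddings, all pure embeddings, and let $K$ be a class of left $R$-modules closed under direct sums, $\mathcal{M}$-submodules and $\mathcal{M}$-epimorphic images. The following are equivalent. \begin{enumerate} \item $(K, \mathcal{M})$ is noetherian. \item The pair $\mathcal{K}_{\mathcal{M}\text{-inj}} = (\mathcal{K}_\mathcal{M}\text{-injective modules}, \leq_\mathcal{M})$ is an abstract elementary class. \end{enumerate}
   Context: Rings are associative with unity; modules are left $R$-modules; $\|A\|$ is the cardinality of $A$. Pure embeddings and pure epimorphisms are meant in the usual sense. A short exact sequence $0 \to A \xrightarrow{f} B \xrightarrow{g} C \to 0$ is $RD$-exact if $f[A] \cap rB = r f[A]$ for every $r \in R$; then $f$ is an $RD$-embedding and $g$ an $RD$-epimorphism. An $\mathcal{M}$-embedding is a member of $\mathcal{M}$; an $\mathcal{M}$-epimorphism is the map $g$ in a short exact sequence $0 \to A \xrightarrow{f} B \xrightarrow{g} C \to 0$ with $f \in \mathcal{M}$ (for $\mathcal{M}$ the class of all embeddings, any surjective homomorphism). $A \leq_\mathcal{M} B$ means that $A$ is a submodule of $B$ and the inclusion is in $\mathcal{M}$. Closure of $K$ under $\mathcal{M}$-submodules: $A \in K$, $B \leq_\mathcal{M} A$ imply $B \in K$; under $\mathcal{M}$-epimorphic images: if $f : A \to B$ is an $\mathcal{M}$-epimorphism and $A \in K$ then $B \in K$. A module $E \in K$ is $\mathcal{K}_\mathcal{M}$-injective if for every $\mathcal{M}$-embedding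 $f: A \to B$ with $A, B \in K$ and every homomorphism $g: A \to E$ there is a homomorphism $h: B \to E$ with $h \circ f = g$. $(K, \mathcal{M})$ is noetherian if every direct sum of $\mathcal{K}_\mathcal{M}$-injective modules is $\mathcal{K}_\mathcal{M}$-injective. An abstract elementary class (here in the language of $R$-modules, so substructures are submodules) is a pair $(C, \leq)$ where $C$ is a class of structures in a fixed language and $\leq$ is a partial order on $C$ extending the substructure relation such that: (i) $C$ and $\leq$ are closed under isomorphisms; (ii) (coherence) if $M_0 \subseteq M_1$, $M_0 \leq M_2$ and $M_1 \leq M_2$, then $M_0 \leq M_1$; (iii) (Tarski-Vaught) if $\{M_i : i < \delta\}$, $\delta$ a limit ordinal, is a $\leq$-increasing chain in $C$, then $M_\delta = \bigcup_{i<\delta} M_i \in C$, $M_i \leq M_\delta$ for all $i$, and if $N \in C$ with $M_i \leq N$ for all $i$ then $M_\delta \leq N$; (iv) (L\''owenheim-Skolem-Tarski) there is a cardinal $\lambda \geq \aleph_0$, at least the size of the language, such that for every $M \in C$ and $A \subseteq |M|$ there is $M_0 \leq M$ with $A \subseteq |M_0|$ and $\|M_0\| \leq |A| + \lambda$; the least such $\lambda$ is the L\''owenheim-Skolem number. *)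

(* Defs.v *)
From HB Require Import structures.
From mathcomp Require Import all_boot all_order all_algebra.
From mathcomp Require Import boolp classical_sets functions cardinality.
From mathcomp Require Import wochoice.

Set Implicit Arguments.
Unset Strict Implicit.
Unset Printing Implicit Defensive.

Import GRing.Theory.
Local Open Scope classical_set_scope.
Local Open Scope ring_scope.
Local Open Scope card_scope.

(* The sets of the informal development are the types of the universe in which
   the carriers of the modules live. Index sets of direct sums, ordinals and
   cardinals have to range over that same universe: a cardinal taken in a
   larger one could bound the size of all modules at once. *)
Notation smallType := Type@{GRing.Lmodule.axioms_.u0}.

Definition modClass (R : pzRingType) := lmodType R -> Prop.

Definition homClass (R : pzRingType) :=
  forall A B : lmodType R, {linear A -> B} -> Prop.

Definition submodT (R : pzRingType) (U : lmodType R) (S : submodClosed U) :=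
  {x : U | x \in S}.

Section SubmodT.
Variables (R : pzRingType) (U : lmodType R) (S : submodClosed U).
HB.instance Definition _ := SubChoice.on (submodT S).
HB.instance Definition _ := [SubChoice_isSubLmodule of submodT S by <:].
End SubmodT.

Section Inclusion.
Variables (R : pzRingType) (U : lmodType R) (A B : submodClosed U).
Hypothesis AB : {subset A <= B}.

Definition incl (x : submodT A) : submodT B :=
  exist _ (val x) (AB (valP x)).

Fact incl_is_linear : linear incl.
Proof. by move=> r x y; apply: val_inj; rewrite !linearP. Qed.

HB.instance Definition _ :=
  GRing.isLinear.Build R (submodT A) (submodT B) _ incl incl_is_linear.
End Inclusion.

Definition dprod (R : pzRingType) (I : smallType) (E : I -> lmodType R) :=
  forall i, E i.

Section Dprod.
Variables (R : pzRingType) (I : smallType) (E : I -> lmodType R).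
Implicit Types f g h : dprod E.

HB.instance Definition _ := gen_eqMixin (dprod E).
HB.instance Definition _ := gen_choiceMixin (dprod E).

Let add f g : dprod E := fun i => f i + g i.
Let opp f : dprod E := fun i => - f i.
Let zero : dprod E := fun i => 0.
Let scale (r : R) f : dprod E := fun i => r *: f i.

Let addA : associative add.
Proof. by move=> f g h; apply: functional_extensionality_dep => i;
  apply: addrA. Qed.
Let addC : commutative add.
Proof. by move=> f g; apply: functional_extensionality_dep => i;
  apply: addrC. Qed.
Let add0 : left_id zero add.
Proof. by move=> f; apply: functional_extensionality_dep => i;
  apply: add0r. Qed.
Let addN : left_inverse zero opp add.
Proof. by move=> f; apply: functional_extensionality_dep => i;
  apply: addNr. Qed.

HB.instance Definition _ := GRing.isZmodule.Build (dprod E) addA addC add0 addN.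

Let scaleA r s f : scale r (scale s f) = scale (r * s) f.
Proof. by apply: functional_extensionality_dep => i; apply: scalerA. Qed.
Let scale1 : left_id 1 scale.
Proof. by move=> f; apply: functional_extensionality_dep => i;
  apply: scale1r. Qed.
Let scaleDr : right_distributive scale +%R.
Proof. by move=> r f g; apply: functional_extensionality_dep => i;
  apply: scalerDr. Qed.
Let scaleDl f : {morph scale^~ f : r s / r + s}.
Proof. by move=> r s; apply: functional_extensionality_dep => i;
  apply: scalerDl. Qed.

HB.instance Definition _ :=
  GRing.Zmodule_isLmodule.Build R (dprod E) scaleA scale1 scaleDr scaleDl.

Definition finsupp : {pred dprod E} :=
  [pred f : dprod E | `[< finite_set [set i | f i <> 0] >]].

Fact finsupp_submod_closed : submod_closed finsupp.
Proof.
split.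
  by apply: asboolT; apply: sub_finite_set (finite_set0 I) => i.
move=> r f g /asboolW ff /asboolW fg; apply: asboolT.
have ffg : finite_set ([set i | f i <> 0] `|` [set i | g i <> 0]).
  by rewrite finite_setU.
apply: sub_finite_set ffg => i /= fg0.
have [f0|] := pselect (f i = 0); last by left.
have [g0|] := pselect (g i = 0); last by right.
by case: fg0; rewrite -[LHS]/(r *: f i + g i) f0 g0 scaler0 addr0.
Qed.

HB.instance Definition _ :=
  GRing.isSubmodClosed.Build R (dprod E) finsupp finsupp_submod_closed.

Definition dsum : lmodType R := submodT finsupp.
End Dprod.

Section Classes.
Variable R : pzRingType.
Implicit Types (K : modClass R) (M : homClass R).

Definition embedding : homClass R := fun A B f => injective f.

Definition rd_embedding : homClass R := fun A B f =>
  injective f /\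
  forall r : R, range f `&` range ( *:%R r : B -> B) = *:%R r @` range f.

(* Every finite system of linear equations over R with constants in f[A] that
   is solvable in B is solvable in f[A]. *)
Definition pure_embedding : homClass R := fun A B f =>
  injective f /\
  forall (m n : nat) (r : 'M[R]_(m, n)) (a : 'I_m -> A),
    (exists b : 'I_n -> B, forall i, \sum_j r i j *: b j = f (a i)) ->
    exists x : 'I_n -> A, forall i, \sum_j r i j *: x j = a i.

Definition short_exact (A B C : lmodType R)
    (f : {linear A -> B}) (g : {linear B -> C}) :=
  [/\ injective f, range f = g @^-1` [set 0] & range g = setT].

Definition epi M (B C : lmodType R) (g : {linear B -> C}) :=
  exists (A : lmodType R) (f : {linear A -> B}), short_exact f g /\ M A B f.

(* Since modules are types, the relation of being a submodule is expressed
   between submodules A, B of a common ambient module U. *)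
Definition le_sub M (U : lmodType R) (A B : submodClosed U) :=
  exists AB : {subset A <= B}, M (submodT A) (submodT B) (incl AB).

Definition closed_dsum K :=
  forall (I : smallType) (E : I -> lmodType R),
    (forall i, K (E i)) -> K (dsum E).

Definition closed_sub K M :=
  forall (U : lmodType R) (A B : submodClosed U),
    K (submodT A) -> le_sub M B A -> K (submodT B).

Definition closed_epi K M :=
  forall (A B : lmodType R) (f : {linear A -> B}), epi M f -> K A -> K B.

Definition rel_injective K M : modClass R := fun E =>
  K E /\
  forall (A B : lmodType R) (f : {linear A -> B}), K A -> K B -> M A B f ->
  forall g : {linear A -> E}, exists h : {linear B -> E}, h \o f =1 g.

Definition noetherian K M :=
  forall (I : smallType) (E : I -> lmodType R),
    (forall i, rel_injective K M (E i)) -> rel_injective K M (dsum E).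

Definition limit_order (W : smallType) (le : rel W) :=
  [/\ well_order le, inhabited W & forall i, exists2 j, le i j & j <> i].

(* Abstract elementary classes of R-modules. As for le_sub, the relation of the
   class is given between submodules of a common ambient module. This loses no
   generality, the class being closed under isomorphisms: the structures
   occurring in each axiom are all submodules of the largest of them, or of the
   union of the chain. The relation is only meaningful between members of C. *)
Record is_AEC (C : modClass R)
    (le : forall U : lmodType R, submodClosed U -> submodClosed U -> Prop) := {
  aec_sub (U : lmodType R) (A B : submodClosed U) :
    C (submodT A) -> C (submodT B) -> le U A B -> {subset A <= B};
  aec_refl (U : lmodType R) (A : submodClosed U) :
    C (submodT A) -> le U A A;
  aec_anti (U : lmodType R) (A B : submodClosed U) :
    C (submodT A) -> C (submodT B) -> le U A B -> le U B A -> A =i B;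
  aec_trans (U : lmodType R) (A B D : submodClosed U) :
    C (submodT A) -> C (submodT B) -> C (submodT D) ->
    le U A B -> le U B D -> le U A D;
  aec_iso (A B : lmodType R) (f : {linear A -> B}) :
    bijective f -> C A -> C B;
  aec_iso_le (U V : lmodType R) (A B : submodClosed U) (A' B' : submodClosed V)
      (f : {linear submodT B -> submodT B'}) :
    C (submodT A) -> C (submodT B) -> {subset A <= B} -> {subset A' <= B'} ->
    bijective f -> (forall x, (val (f x) \in A') = (val x \in A)) ->
    le U A B -> le V A' B';
  aec_coherence (U : lmodType R) (M0 M1 M2 : submodClosed U) :
    C (submodT M0) -> C (submodT M1) -> C (submodT M2) ->
    {subset M0 <= M1} -> le U M0 M2 -> le U M1 M2 -> le U M0 M1;
  aec_chain (U : lmodType R) (W : smallType) (leW : rel W)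
      (M : W -> submodClosed U) :
    limit_order leW -> (forall i, C (submodT (M i))) ->
    (forall i j, leW i j -> le U (M i) (M j)) ->
    exists S : submodClosed U,
      [/\ forall x, x \in S <-> exists i, x \in M i,
          C (submodT S),
          forall i, le U (M i) S
        & forall N : submodClosed U, C (submodT N) ->
            (forall i, le U (M i) N) -> le U S N];
  aec_LST : exists L : smallType,
    [/\ [set: nat] #<= [set: L], [set: R] #<= [set: L]
      & forall (U : lmodType R) (M : submodClosed U) (A : set U),
          C (submodT M) -> A `<=` [set` M] ->
          exists M0 : submodClosed U,
            [/\ C (submodT M0), le U M0 M, A `<=` [set` M0]
              & [set: submodT M0] #<= [set: (A + L)%type]]] }.

End Classes.

(* Main.v *)
From HB Require Import structures.
From mathcomp Require Import all_boot all_order all_algebra.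
From mathcomp Require Import boolp classical_sets functions cardinality.
From mathcomp Require Import fsbigop wochoice.
Require Import Defs.

(** The three classes of embeddings are treated at once. Each consists of the
    injective maps that reflect the solvability of certain finite systems of
    linear equations: none for embeddings, a single equation in one unknown for
    RD-embeddings, all systems for pure embeddings ([pure_map], with the
    parameter [Sig]). Split embeddings are of each kind, and purity passes to
    directed unions because a system involves finitely many constants.
    Injective means relatively injective below, and small means of a size
    bounded in terms of [R].

    If the injective modules form an abstract elementary class, well-order the
    index set of a direct sum of injective modules. The partial sums over the
    initial segments are injective by induction: a successor step adds one
    summand, and a limit step is an instance of the chain axiom ([inj_dsum]).

    Conversely, assume that direct sums of injective modules are injective. An
    injective module embedded in another one by a map of the class is a direct
    summand of it ([complement]). The union of a chain of injective modules is
    therefore injective: it is the direct sum of complements in the members of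
    the chain of the unions of the preceding ones ([chain_union_inj]). Most of
    the other axioms are formal, and there remains the Loewenheim-Skolem-Tarski
    axiom.

    It rests on a Baer criterion ([baer]): a module of [K] is injective as soon
    as maps into it extend along the inclusions of the class between small
    modules of [K]. Indeed a maximal pure partial extension is defined
    everywhere, since it can be extended to the sum of its domain with a
    suitable small pure submodule that contains a given element ([small_hull]).
    There is only a set of such extension problems up to isomorphism. Closing
    an element of an injective module under solutions of these problems yields
    a small injective submodule ([small_inj]). By Zorn's lemma, every injective
    module is then a direct sum of small injective modules
    ([small_decomposition]): a maximal independent family with a pure sum
    exhausts the module, since its sum is injective and so has an injective
    complement. Now a subset [A] of an injective module involves finitely many
    components per element, and the sum of all the components involved is an
    injective summand ([lowenheim_skolem]). Its size is bounded as required
    because an infinite set has as many finite sequences as elements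
    ([seq_inj]). *)

Set Implicit Arguments.
Unset Strict Implicit.
Unset Printing Implicit Defensive.

Import GRing.Theory.
Local Open Scope classical_set_scope.
Local Open Scope ring_scope.
Local Open Scope card_scope.

(** * Choice and Zorn's lemma *)

Lemma choice_on (T U : Type) (D : set T) (P : T -> U -> Prop) (u0 : T -> U) :
  (forall x, D x -> exists y, P x y) ->
  exists f : T -> U, forall x, D x -> P x (f x).
Proof.
move=> DP.
have DP' x : exists y, D x -> P x y.
  by have [/DP[y Py]|nDx] := pselect (D x); [exists y|exists (u0 x)].
by have [f fP] := choice DP'; exists f.
Qed.

Lemma inj_surj_bij (X Y : Type) (f : X -> Y) :
  injective f -> (forall y, exists x, f x = y) -> bijective f.
Proof.
move=> f_inj /choice[g gK]; exists g => // x.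
by apply: f_inj; rewrite gK.
Qed.

(** Zorn's lemma for inclusion, above a given set: since the empty chain is
    taken care of by the starting point, [P] need only be stable under unions
    of nonempty chains, which is what the applications below can provide. *)
Lemma Zorn_above (T : Type) (P : set (set T)) (X0 : set T) :
  P X0 ->
  (forall F : set (set T), F !=set0 -> F `<=` P -> total_on F subset ->
     P (\bigcup_(X in F) X)) ->
  exists X, [/\ P X, X0 `<=` X & forall Y, P Y -> X `<=` Y -> Y = X].
Proof.
move=> PX0 PU.
(* The empty set is admitted so that the union of the empty chain qualifies. *)
have [|X [[[PX X0X]|X_0] Xmax]] :=
  @Zorn_bigcup T (fun X => (P X /\ X0 `<=` X) \/ X = set0).
- move=> F FP Ftot.
  have [[X [FX [PX X0X]]]|noX] :=
    pselect (exists X, F X /\ (P X /\ X0 `<=` X)); last first.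
    right; apply/seteqP; split=> // x [X FX Xx].
    case: (FP X FX) => [PX|X_0]; first by case: noX; exists X.
    by rewrite X_0 in Xx.
  left; split; last by move=> x /X0X Xx; exists X.
  pose F' : set (set T) := F `&` (fun Y => P Y /\ X0 `<=` Y).
  have -> : \bigcup_(Y in F) Y = \bigcup_(Y in F') Y.
    apply/seteqP; split=> x [Y]; last by case=> FY _ Yx; exists Y.
    move=> FY Yx; exists Y => //; split=> //.
    by case: (FP Y FY) => [//|Y0]; rewrite Y0 in Yx.
  apply: PU; first by exists X.
    by move=> Y [_ []].
  by move=> Y Z [FY _] [FZ _]; apply: Ftot.
- exists X; split=> // Y PY XY.
  apply: contrapT => YX; apply: (Xmax Y); last first.
    by left; split=> // x /X0X /XY.
  by split=> // YsX; apply: YX; apply/seteqP.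
exists X0; split=> // Y PY X0Y.
have Y0 : Y = set0.
  apply: contrapT => Yn0; apply: (Xmax Y); last by left.
  by rewrite X_0; split=> // sY0; apply: Yn0; apply/seteqP; split.
by rewrite Y0 in X0Y *; apply/seteqP; split.
Qed.

Lemma chain_two (T : Type) (F : set (set T)) (p q : T) : total_on F subset ->
  (\bigcup_(X in F) X) p -> (\bigcup_(X in F) X) q ->
  exists X, [/\ F X, X p & X q].
Proof.
move=> Ftot [X FX Xp] [Z FZ Zq]; have [XZ|ZX] := Ftot X Z FX FZ.
  by exists Z; split=> //; apply: XZ.
by exists X; split=> //; apply: ZX.
Qed.

(** * Finite sequences over an infinite set *)

(** A maximal injective partial function from [A] to [B] is total or onto. *)
Lemma comparable_sets (Y : Type) (A B : set Y) :
  (exists2 f : Y -> Y, {in A &, injective f} & f @` A `<=` B) \/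
  (exists2 f : Y -> Y, {in B &, injective f} & f @` B `<=` A).
Proof.
pose P (G : set (Y * Y)) :=
  [/\ forall p, G p -> A p.1 /\ B p.2,
      forall x y y', G (x, y) -> G (x, y') -> y = y'
    & forall x x' y, G (x, y) -> G (x', y) -> x = x'].
have [| |G [[GAB Gf Gi] _ Gmax]] := @Zorn_above _ P set0.
- by split.
- move=> F _ FP Ftot; split.
  + by move=> p [G FG Gp]; have [H _ _] := FP G FG; apply: H.
  + move=> x y y' p q; have [G [FG Gp Gq]] := chain_two Ftot p q.
    by have [_ Gf _] := FP G FG; apply: Gf Gp Gq.
  + move=> x x' y p q; have [G [FG Gp Gq]] := chain_two Ftot p q.
    by have [_ _ Gi] := FP G FG; apply: Gi Gp Gq.
have [domA|/existsNP[a /not_implyP[Aa na]]] :=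
    pselect (forall a, A a -> exists b, G (a, b)).
  left; have [f fG] := choice_on id domA.
  exists f; last by move=> _ [a Aa <-]; have [] := GAB _ (fG _ Aa).
  move=> x y /set_mem Ax /set_mem Ay fxy; apply: Gi (fG _ Ax) _.
  by rewrite fxy; apply: fG.
have ranB b : B b -> exists a, G (a, b).
  move=> Bb; apply: contrapT => nb.
  have : (G `|` [set (a, b)]) = G.
    apply: Gmax; last by left.
    split.
    + by move=> p [/GAB//|->].
    + move=> x y y' [Gp|[ex ->]] [Gp'|[ex' ->]] //; first exact: Gf Gp Gp'.
        by case: na; exists y; rewrite -ex'.
      by case: na; exists y'; rewrite -ex.
    + move=> x x' y [Gp|[-> ey]] [Gp'|[-> ey']] //; first exact: Gi Gp Gp'.
        by case: nb; exists x; rewrite -ey'.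
      by case: nb; exists x'; rewrite -ey.
  move/seteqP => [/(_ (a, b) (or_intror erefl)) Gab _].
  by case: na; exists b.
right; have [f fG] := choice_on id ranB.
exists f; last by move=> _ [b Bb <-]; have [] := GAB _ (fG _ Bb).
move=> x y /set_mem Bx /set_mem By fxy; apply: Gf (fG _ Bx) _.
by rewrite fxy; apply: fG.
Qed.

Section SeqInj.
Variable Y : eqType.

Definition over (D : set Y) (s : seq Y) := forall y, y \in s -> D y.

Lemma over_cons (D : set Y) y s : over D (y :: s) <-> D y /\ over D s.
Proof.
split=> [H|[Dy Ds] z].
  by split=> [|z zs]; apply: H; rewrite inE ?eqxx ?zs ?orbT.
by rewrite inE => /orP[/eqP->|/Ds].
Qed.

Lemma over_cat (D : set Y) s t : over D (s ++ t) <-> over D s /\ over D t.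
Proof.
split=> [H|[Ds Dt] z].
  by split=> z zs; apply: H; rewrite mem_cat zs ?orbT.
by rewrite mem_cat => /orP[/Ds|/Dt].
Qed.

Lemma over_flatten (D E : set Y) (c : Y -> seq Y) (s : seq Y) :
  (forall y, D y -> over E (c y)) -> over D s -> over E (flatten (map c s)).
Proof.
move=> cE; elim: s => [|y s IH] //= /over_cons[Dy Ds].
by apply/over_cat; split; [apply: cE|apply: IH].
Qed.

(** A code whose words have the same nonzero length is uniquely decodable. *)
Lemma flatten_inj (D : set Y) (c : Y -> seq Y) (n : nat) :
  (forall y, D y -> size (c y) = n.+1) ->
  (forall x y, D x -> D y -> c x = c y -> x = y) ->
  forall s t, over D s -> over D t ->
    flatten (map c s) = flatten (map c t) -> s = t.
Proof.
move=> cs ci; elim=> [|x s IH] [|y t] //=.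
- move=> _ /over_cons[Dy _] e; have := congr1 size e.
  by rewrite size_cat cs.
- move=> /over_cons[Dx _] _ e; have := congr1 size e.
  by rewrite size_cat cs.
move=> /over_cons[Dx Ds] /over_cons[Dy Dt] /eqP.
rewrite eqseq_cat ?cs// => /andP[/eqP /(ci _ _ Dx Dy)-> /eqP e].
by rewrite (IH t).
Qed.

(** Zorn's lemma is applied to the injections of [seq D] into [D], for [D] a subset of
    [Y]; they are handled as graphs, from which [D] is recovered as the set of
    the [y] such that the one-element sequence of [y] is in the domain. Such an
    injection exists for a countable [D]. Let [D] be maximal. If [D] embeds
    into its complement by [j], then it can be enlarged to the union of [D] and
    [j D], since sequences over the latter are coded by sequences over [D] of
    twice the length, so that the new ones embed into [j D]. Otherwise the
    complement of [D] embeds into [D], and the same coding embeds [seq Y] into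
    [seq D]. *)
Lemma seq_inj (i : nat -> Y) : injective i ->
  exists f : seq Y -> Y, injective f.
Proof.
move=> i_inj.
pose dom (G : set (seq Y * Y)) : set Y := [set y | exists z, G ([:: y], z)].
pose P (G : set (seq Y * Y)) :=
  [/\ forall s, (exists z, G (s, z)) <-> over (dom G) s,
      forall s z, G (s, z) -> dom G z,
      forall s z z', G (s, z) -> G (s, z') -> z = z'
    & forall s s' z, G (s, z) -> G (s', z) -> s = s'].
pose G0 : set (seq Y * Y) :=
  [set p | exists2 t : seq nat, p.1 = map i t & p.2 = i (pickle t)].
have domG0 y : dom G0 y <-> exists n, y = i n.
  split=> [[z [[|n [|? ?]] //= [->] _]]|[n ->]]; first by exists n.
  by exists (i (pickle [:: n])); exists [:: n].
have [| |G [[Gdom Gran Gf Gi] G0G Gmax]] := @Zorn_above _ P G0.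
- split.
  + move=> s; split.
      move=> [z [t /= -> _]] y /mapP[n _ ->]; apply/domG0.
      by exists n.
    elim: s => [_|y s IH /over_cons[/domG0[n ->] /IH[z [t /= -> _]]]].
      by exists (i (pickle ([::] : seq nat))); exists [::].
    by exists (i (pickle (n :: t))); exists (n :: t).
  + by move=> s z [t /= _ ->]; apply/domG0; exists (pickle t).
  + move=> s z z' [t /= -> ->] [t' /= e ->].
    by rewrite (inj_map i_inj e).
  + move=> s s' z [t /= -> ->] [t' /= -> /i_inj e].
    by rewrite (pcan_inj (@pickleK (seq nat)) e).
- move=> F [H FH] FP Ftot; split.
  + move=> s; split.
      move=> [z [X FX Xsz]] y ys.
      have [Xd _ _ _] := FP X FX.
      have /Xd /(_ y ys)[w Xw] : exists z, X (s, z) by exists z.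
      by exists w, X.
    move=> sD.
    suff [X FX sX] : exists2 X, F X & over (dom X) s.
      have [Xd _ _ _] := FP X FX.
      by have /Xd[z Xz] := sX; exists z, X.
    elim: s sD => [_|y s IH /over_cons[[w [X FX Xw]] /IH[Z FZ Zs]]].
      by exists H.
    have [XZ|ZX] := Ftot X Z FX FZ.
      by exists Z => //; apply/over_cons; split=> //; exists w; apply: XZ.
    exists X => //; apply/over_cons; split; first by exists w.
    by move=> z /Zs[v Zv]; exists v; apply: ZX.
  + move=> s z [X FX Xsz]; have [_ Xr _ _] := FP X FX.
    by have [w Xw] := Xr _ _ Xsz; exists w, X.
  + move=> s z z' p q; have [X [FX Xp Xq]] := chain_two Ftot p q.
    by have [_ _ Xf _] := FP X FX; apply: Xf Xp Xq.
  + move=> s s' z p q; have [X [FX Xp Xq]] := chain_two Ftot p q.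
    by have [_ _ _ Xi] := FP X FX; apply: Xi Xp Xq.
pose D := dom G.
have [f fG] := choice_on (fun=> i 0%N) (fun s => iffRL (Gdom s)).
have fD s : over D s -> D (f s) by move=> /fG /Gran.
have f_inj s t : over D s -> over D t -> f s = f t -> s = t.
  by move=> Ds Dt e; apply: Gi (fG s Ds) _; rewrite e; apply: fG.
have Di n : D (i n) by exists (i (pickle [:: n])); apply: G0G; exists [:: n].
(* The second letter of a code word tells whether the first one is the coded
   element or stands for it through [j]. *)
pose code (j : Y -> Y) y :=
  if `[< D y >] then [:: y; i 0%N] else [:: j y; i 1%N].
have codeD j y : D y -> code j y = [:: y; i 0%N].
  by move=> Dy; rewrite /code asboolT.
have codeN j y : ~ D y -> code j y = [:: j y; i 1%N].
  by move=> Dy; rewrite /code asboolF.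
have code_over (j : Y -> Y) y : (~ D y -> D (j y)) -> over D (code j y).
  move=> jy; have [Dy|nDy] := pselect (D y); [rewrite codeD//|rewrite codeN//];
    by do ?[apply/over_cons; split] => //; apply: jy.
have code_inj (S : set Y) (j : Y -> Y) :
    (forall x y, S x -> S y -> ~ D x -> ~ D y -> j x = j y -> x = y) ->
    forall s t, over S s -> over S t ->
      flatten (map (code j) s) = flatten (map (code j) t) -> s = t.
  move=> j_inj; apply: (@flatten_inj S _ 1).
    by move=> y _; rewrite /code; case: ifP.
  move=> x y Sx Sy.
  have [Dx|Dx] := pselect (D x); have [Dy|Dy] := pselect (D y);
    rewrite ?(codeD _ _ Dx) ?(codeD _ _ Dy) ?(codeN _ _ Dx) ?(codeN _ _ Dy).
  - by case.
  - by case=> _ /i_inj.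
  - by case=> _ /i_inj.
  - by case; apply: j_inj.
have [[j j_inj jD]|[j j_inj jD]] := comparable_sets D (~` D); last first.
  have jD' y : ~ D y -> D (j y) by move=> nDy; apply: jD; exists y.
  exists (fun s => f (flatten (map (code j) s))) => s t e.
  apply: (code_inj setT j) => //.
    by move=> x y _ _ nDx nDy; apply: j_inj; apply/mem_set.
  have cD u : over D (flatten (map (code j) u)).
    apply: (@over_flatten setT) => // y _; apply: code_over; exact: jD'.
  exact: f_inj e.
exfalso.
have [k kP] : exists k : Y -> Y, forall y, (j @` D) y -> D (k y) /\ j (k y) = y.
  have jDP y : (j @` D) y -> exists d, D d /\ j d = y.
    by move=> [d Dd <-]; exists d.
  exact: choice_on id jDP.
pose D' := D `|` j @` D.
have kD' y : D' y -> ~ D y -> D (k y) /\ j (k y) = y.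
  by move=> [//|/kP].
have cD y : D' y -> over D (code k y).
  by move=> D'y; apply: code_over => nDy; have [] := kD' y D'y nDy.
pose c s := flatten (map (code k) s).
have c_inj s t : over D' s -> over D' t -> c s = c t -> s = t.
  apply: code_inj => x y D'x D'y nDx nDy e.
  have [_ <-] := kD' x D'x nDx; have [_ <-] := kD' y D'y nDy.
  by rewrite e.
pose G' := G `|` [set p | [/\ over D' p.1, ~ over D p.1 & p.2 = j (f (c p.1))]].
have fcD s : over D' s -> D (f (c s)) by move=> /(over_flatten cD)/fD.
have GD s z : G (s, z) -> over D s by move=> Gsz; apply/Gdom; exists z.
have jnD d : D d -> ~ D (j d) by move=> Dd; apply: jD; exists d.
have over1 (E : set Y) y : E y -> over E [:: y].
  by move=> Ey; apply/over_cons.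
have domG' : dom G' = D'.
  apply/seteqP; split=> y.
    by move=> [z [Gyz|[/= /over_cons[]//]]]; left; exists z.
  move=> D'y; have [Dy|nDy] := pselect (D y).
    by case: Dy => z Gz; exists z; left.
  exists (j (f (c [:: y]))); right; split=> //=; first exact: over1.
  by move=> /over_cons[].
have G'G : G' = G.
  apply: Gmax; last by left.
  rewrite /P domG'; split.
  - move=> s; split.
      by case=> z [/GD sD|[]//] y /sD; left.
    move=> D's; have [Ds|nDs] := pselect (over D s).
      by exists (f s); left; apply: fG.
    by exists (j (f (c s))); right.
  - move=> s z [/Gran|[/= D's _ ->]]; first by left.
    by right; exists (f (c s)) => //; apply: fcD.
  - move=> s z z' [Gz|[/= D's nDs ->]] [Gz'|[/= _ nDs' ->]] //.
    + exact: Gf Gz Gz'.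
    + by case: nDs'; apply: GD Gz.
    + by case: nDs; apply: GD Gz'.
  - move=> s s' z [Gz|[/= D's nDs ->]] [Gz'|[/= D's' nDs']].
    + exact: Gi Gz Gz'.
    + by move=> e; case: (jnD _ (fcD _ D's')); rewrite -e; apply: Gran Gz.
    + by case: (jnD _ (fcD _ D's)); apply: Gran Gz'.
    + move=> /j_inj => /(_ (mem_set (fcD _ D's)) (mem_set (fcD _ D's'))).
      move=> /f_inj => /(_ (over_flatten cD D's) (over_flatten cD D's')).
      exact: c_inj.
have D'j : D' (j (i 0%N)) by right; exists (i 0%N).
case: (jnD _ (Di 0%N)).
by rewrite -/D; move: D'j; rewrite -domG' G'G.
Qed.

End SeqInj.

(** * Well-orders *)

Section WellOrder.
Variables (W : Type) (le : rel W).
Hypothesis wo : well_order le.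

Lemma wo_min (A : set W) : A !=set0 -> exists2 m, A m & forall x, A x -> le m x.
Proof.
move=> [a Aa]; have [|m [[mA mmin] _]] := @wo [pred x | `[< A x >]].
  by exists a; apply/asboolP.
exists m; first exact/asboolP.
by move=> x Ax; apply: mmin; apply/asboolP.
Qed.

Lemma wo_total x y : le x y \/ le y x.
Proof.
have [|m mxy mmin] := @wo_min [set z | z = x \/ z = y]; first by exists x; left.
by case: mxy => <-; [left|right]; apply: mmin; [right|left].
Qed.

Lemma wo_refl x : le x x.
Proof. by case: (wo_total x x). Qed.

Lemma wo_anti x y : le x y -> le y x -> x = y.
Proof.
move=> xy yx; have [|m [_ muniq]] := @wo [pred z | `[< z = x \/ z = y >]].
  by exists x; apply/asboolP; left.
have mE z : z = x \/ z = y -> m = z.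
  move=> zE; apply: muniq; split; first exact/asboolP.
  by move=> t /asboolP[] ->; case: zE => -> //; apply: wo_refl.
by rewrite -[LHS](mE x (or_introl erefl)); apply: mE; right.
Qed.

Lemma wo_trans y x z : le x y -> le y z -> le x z.
Proof.
move=> xy yz.
have [|m mE mmin] := @wo_min [set t | [\/ t = x, t = y | t = z]].
  by exists x; apply: Or31.
have mx := mmin x (Or31 _ _ erefl); have my := mmin y (Or32 _ _ erefl).
have mz := mmin z (Or33 _ _ erefl).
case: mE => mE; first by rewrite -{1}mE.
  by rewrite (wo_anti xy) // -mE.
by have -> : z = y by apply: wo_anti yz; rewrite -mE.
Qed.

Lemma wo_ind (P : W -> Prop) :
  (forall i, (forall j, le j i -> j <> i -> P j) -> P i) -> forall i, P i.
Proof.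
move=> IH i; apply: contrapT => nPi.
have [|m nPm mmin] := @wo_min [set j | ~ P j]; first by exists i.
apply: nPm; apply: IH => j jm nejm; apply: contrapT => /mmin mj.
by apply: nejm; apply: wo_anti.
Qed.
End WellOrder.

Lemma wo_max_seq (W : eqType) (le : rel W) (s : seq W) : well_order le ->
  s <> [::] -> exists2 m, m \in s & {in s, forall x, le x m}.
Proof.
move=> wo; elim: s => // x s IH _; have [->|/IH[m ms mmax]] := pselect (s = [::]).
  by exists x; [exact: mem_head|move=> y; rewrite inE => /eqP->; apply: wo_refl].
have [xm|mx] := wo_total wo x m.
  exists m; first by rewrite inE ms orbT.
  by move=> y; rewrite inE => /orP[/eqP->//|/mmax].
exists x; first exact: mem_head.
move=> y; rewrite inE => /orP[/eqP->|/mmax ym]; first exact: wo_refl.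
exact: wo_trans ym mx.
Qed.

(** * Submodules and linear maps *)

Section Modules.
Variable R : pzRingType.
Implicit Types U V A B E : lmodType R.

(** Submodules are mostly handled as sets with this property, since they arise
    from set-theoretic constructions; [subm] below turns them into structures. *)
Definition submodule U (S : set U) :=
  S 0 /\ forall r x y, S x -> S y -> S (r *: x + y).

Section SubmoduleOf.
Variables (U : lmodType R) (S : set U) (HS : submodule S).

Let mem_pred : {pred U} := [pred x | `[< S x >]].

Let mem_pred_closed : submod_closed mem_pred.
Proof.
have [S0 SD] := HS; split; first exact/asboolP.
by move=> r x y /asboolP Sx /asboolP Sy; apply/asboolP; apply: SD.
Qed.

Definition subm : submodClosed U :=
  HB.pack mem_pred (GRing.isSubmodClosed.Build R U mem_pred mem_pred_closed).

Lemma submP x : reflect (S x) (x \in subm).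
Proof. exact: asboolP. Qed.

Lemma subm_set : [set` subm] = S.
Proof. by apply/seteqP; split=> x /submP. Qed.
End SubmoduleOf.
Arguments submP {U S HS x}.

Lemma submodule_mem U (N : submodClosed U) : submodule [set` N].
Proof.
split=> [|r x y /= xN yN]; first exact: rpred0.
by rewrite rpredD// rpredZ.
Qed.

Section MkLinear.
Variables (A B : lmodType R) (f : A -> B) (Hf : linear f).
Definition mklin : {linear A -> B} :=
  HB.pack f (GRing.isLinear.Build R A B _ f Hf).
End MkLinear.

Lemma mklinE A B (f : A -> B) (Hf : linear f) x : mklin Hf x = f x.
Proof. by []. Qed.

Definition inclusion U (N : submodClosed U) : {linear submodT N -> U} := val.

Lemma corestrict A U (N : submodClosed U) (f : {linear A -> U}) :
  (forall x, f x \in N) ->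
  exists f' : {linear A -> submodT N}, forall x, val (f' x) = f x.
Proof.
move=> fN.
have lin : linear (fun x => exist _ (f x) (fN x) : submodT N).
  by move=> r x y; apply: val_inj; rewrite /= !linearP.
by exists (mklin lin).
Qed.

Lemma linear_bij_inv A B (f : {linear A -> B}) : bijective f ->
  exists2 g : {linear B -> A}, cancel f g & cancel g f.
Proof.
move=> [g fK gK]; have lin : linear g.
  by move=> r x y; apply: (can_inj fK); rewrite linearP !gK.
by exists (mklin lin).
Qed.

(** Partial linear maps are encoded as total functions that are linear on a
    given set. *)
Definition linear_on U V (N : set U) (g : U -> V) :=
  forall r x y, N x -> N y -> g (r *: x + y) = r *: g x + g y.

Lemma submoduleZ U (N : set U) r x : submodule N -> N x -> N (r *: x).
Proof. by move=> [N0 ND] Nx; rewrite -[_ *: x]addr0; apply: ND. Qed.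

Lemma submoduleD U (N : set U) x y : submodule N -> N x -> N y -> N (x + y).
Proof. by move=> [N0 ND] Nx Ny; rewrite -[x]scale1r; apply: ND. Qed.

Lemma submodule_sum U (N : set U) (I : Type) (s : seq I) (x : I -> U) :
  submodule N -> (forall i, N (x i)) -> N (\sum_(i <- s) x i).
Proof.
move=> Ns Nx; elim: s => [|i s IH]; first by rewrite big_nil; case: Ns.
by rewrite big_cons; apply: submoduleD.
Qed.

Lemma submoduleB U (N : set U) x y : submodule N -> N x -> N y -> N (x - y).
Proof.
move=> [N0 ND] Nx Ny; rewrite addrC -scaleN1r; exact: ND.
Qed.

Lemma linear_on0 U V (N : set U) (g : U -> V) :
  submodule N -> linear_on N g -> g 0 = 0.
Proof.
move=> [N0 _] gN; have := gN (-1) 0 0 N0 N0.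
by rewrite scaler0 addr0 scaleN1r addNr.
Qed.

Lemma linear_onB U V (N : set U) (g : U -> V) x y :
  linear_on N g -> N x -> N y -> g (x - y) = g x - g y.
Proof.
by move=> gN Nx Ny; rewrite addrC -scaleN1r gN// scaleN1r addrC.
Qed.

Lemma linear_on_sum U V (N : set U) (g : U -> V) (I : Type) (s : seq I)
    (r : I -> R) (x : I -> U) :
  submodule N -> linear_on N g -> (forall i, N (x i)) ->
  g (\sum_(i <- s) r i *: x i) = \sum_(i <- s) r i *: g (x i).
Proof.
move=> Nsub gN Nx; elim: s => [|i s IH];
  first by rewrite !big_nil (linear_on0 Nsub gN).
rewrite !big_cons gN ?IH//.
by apply: submodule_sum => // j; apply: submoduleZ.
Qed.

(** * Linear systems and relative purity *)

Definition solves U m n (r : 'M[R]_(m, n)) (x : 'I_n -> U) (a : 'I_m -> U) :=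
  forall i, \sum_j r i j *: x j = a i.

Lemma solvesB U m n (r : 'M[R]_(m, n)) (x y : 'I_n -> U) (a b : 'I_m -> U) :
  solves r x a -> solves r y b ->
  solves r (fun j => x j - y j) (fun i => a i - b i).
Proof.
move=> xa yb i; rewrite -xa -yb -sumrB.
by apply: eq_bigr => j _; rewrite scalerBr.
Qed.

Lemma solvesD U m n (r : 'M[R]_(m, n)) (x y : 'I_n -> U) (a b : 'I_m -> U) :
  solves r x a -> solves r y b ->
  solves r (fun j => x j + y j) (fun i => a i + b i).
Proof.
move=> xa yb i; rewrite -xa -yb -big_split.
by apply: eq_bigr => j _; rewrite scalerDr.
Qed.

Lemma solves_linear_on U V (N : set U) (g : U -> V) m n (r : 'M[R]_(m, n))
    (x : 'I_n -> U) (a : 'I_m -> U) :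
  submodule N -> linear_on N g -> (forall j, N (x j)) ->
  solves r x a -> solves r (g \o x) (g \o a).
Proof. by move=> Ns gN Nx xa i; rewrite /= -xa (linear_on_sum _ _ Ns gN). Qed.

Lemma linear_onT U V (g : {linear U -> V}) (N : set U) : linear_on N g.
Proof. by move=> r x y _ _; rewrite linearP. Qed.

Lemma submoduleT U : submodule [set: U].
Proof. by []. Qed.

Lemma solves_linear U V (g : {linear U -> V}) m n (r : 'M[R]_(m, n))
    (x : 'I_n -> U) (a : 'I_m -> U) :
  solves r x a -> solves r (g \o x) (g \o a).
Proof.
by apply: (@solves_linear_on _ _ setT); [exact: submoduleT|exact: linear_onT|].
Qed.

Lemma solves_val U (N : submodClosed U) m n (r : 'M[R]_(m, n))
    (x : 'I_n -> submodT N) (a : 'I_m -> submodT N) :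
  solves r (fun j => val (x j)) (fun i => val (a i)) -> solves r x a.
Proof.
move=> xa i; apply: val_inj; rewrite -[RHS]xa linear_sum.
by apply: eq_bigr => j _; rewrite linearZ.
Qed.

Section Purity.
(** The matrices of the systems that embeddings have to reflect: none for plain
    embeddings, those of size 1 for RD-embeddings, all for pure embeddings. *)
Variable Sig : forall m n, 'M[R]_(m, n) -> Prop.

Definition pure_map A B (f : {linear A -> B}) :=
  injective f /\
  forall m n (r : 'M[R]_(m, n)), Sig r -> forall a : 'I_m -> A,
    (exists b, solves r b (f \o a)) -> exists x, solves r x a.

Definition pure_in U (S N : set U) :=
  forall m n (r : 'M[R]_(m, n)), Sig r -> forall a : 'I_m -> U,
    (forall i, S (a i)) ->
    (exists2 b, forall j, N (b j) & solves r b a) ->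
    exists2 x, forall j, S (x j) & solves r x a.

Lemma pure_in_refl U (S : set U) : pure_in S S.
Proof. by []. Qed.

Lemma pure_in_trans U (S N T : set U) : S `<=` N ->
  pure_in S N -> pure_in N T -> pure_in S T.
Proof.
move=> SN pS pN m n r Sr a Sa /(pN _ _ _ Sr)/pS.
by apply=> // i; apply: SN.
Qed.

Lemma pure_in_sub U (S N T : set U) : N `<=` T -> pure_in S T -> pure_in S N.
Proof.
move=> NT pS m n r Sr a Sa [b Nb ba]; apply: pS => //.
by exists b => // j; apply: NT.
Qed.

(** The retraction of a solution is a solution, the constants being fixed. *)
Lemma pure_in_retract U (S N : set U) (q : U -> U) :
  submodule N -> linear_on N q -> (forall x, N x -> S (q x)) ->
  (forall x, S x -> q x = x) -> pure_in S N.
Proof.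
move=> Ns qN NS qS m n r _ a Sa [b Nb ba]; exists (q \o b) => [j|i].
  exact: NS.
by rewrite (solves_linear_on Ns qN Nb ba) /= qS.
Qed.

Lemma directed_fin U (I : Type) (D : set I) (F : I -> set U) (n : nat)
    (a : 'I_n -> U) :
  D !=set0 ->
  (forall i j, D i -> D j -> exists k, [/\ D k, F i `<=` F k & F j `<=` F k]) ->
  (forall k, exists2 i, D i & F i (a k)) ->
  exists2 i, D i & forall k, F i (a k).
Proof.
move=> [i0 Di0] dir; elim: n a => [|n IH] a aF; first by exists i0 => // -[].
have [|i Di ai] := IH (fun k => a (lift ord0 k)); first by move=> k; apply: aF.
have [j Dj aj] := aF ord0.
have [k [Dk ik jk]] := dir i j Di Dj; exists k => // l.
by case: (unliftP ord0 l) => [l' ->|->]; [apply/ik/ai|apply: jk].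
Qed.

(** A system has finitely many constants, which lie in one member of the
    directed union. *)
Lemma pure_in_directed U (I : Type) (D : set I) (F : I -> set U) (N : set U) :
  D !=set0 ->
  (forall i j, D i -> D j -> exists k, [/\ D k, F i `<=` F k & F j `<=` F k]) ->
  (forall i, D i -> pure_in (F i) N) ->
  pure_in (\bigcup_(i in D) F i) N.
Proof.
move=> D0 dir pF m n r Sr a Fa b.
have [i Di ai] : exists2 i, D i & forall k, F i (a k).
  by apply: directed_fin => // k; have [i Di Fi] := Fa k; exists i.
have [x Fx xa] := pF i Di _ _ _ Sr a ai b.
by exists x => // j; exists i.
Qed.

Lemma pure_map_inclusion U (N : submodClosed U) :
  pure_map (inclusion N) <-> pure_in [set` N] setT.
Proof.
split=> [[_ pN] m n r Sr a Na [b _ ba]|pN]; last split; first last.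
- move=> m n r Sr a [b ba].
  have [|x Nx xa] := pN m n r Sr (val \o a) (fun i => valP (a i)).
    by exists b.
  by exists (fun j => exist _ (x j) (Nx j)); apply: solves_val.
- exact: val_inj.
have [|x xa] := pN _ _ _ Sr (fun i => exist _ (a i) (Na i)); first by exists b.
exists (val \o x) => [j|]; first exact: valP.
have := solves_linear (inclusion N) xa.
by [].
Qed.

Lemma pure_map_incl U (S N : submodClosed U) (SN : {subset S <= N}) :
  pure_map (incl SN) <-> pure_in [set` S] [set` N].
Proof.
split=> [[_ pS] m n r Sr a Sa [b Nb ba]|pS].
  have [|x xa] := pS _ _ _ Sr (fun i => exist _ (a i) (Sa i)).
    by exists (fun j => exist _ (b j) (Nb j)); apply: solves_val.
  exists (val \o x) => [j|]; first exact: valP.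
  exact: (solves_linear (inclusion S) xa).
split=> [x y /(congr1 val) /= /val_inj//|m n r Sr a [b ba]].
have [|x Sx xa] := pS m n r Sr (val \o a) (fun i => valP (a i)).
  exists (val \o b); first by move=> j; apply: valP.
  exact: (solves_linear (inclusion N) ba).
by exists (fun j => exist _ (x j) (Sx j)); apply: solves_val.
Qed.

Lemma pure_map_split A B (f : {linear A -> B}) (p : {linear B -> A}) :
  cancel f p -> pure_map f.
Proof.
move=> fK; split; first exact: can_inj fK.
move=> m n r _ a [b ba]; exists (p \o b) => i.
by rewrite (solves_linear p ba) /= fK.
Qed.

Lemma pure_map_range A B (f : {linear A -> B}) :
  pure_map f -> pure_in (range f) setT.
Proof.
move=> [_ pf] m n r Sr a fa [b _ ba].
have [a' a'E] := choice (fun i => let: ex_intro2 x _ e := fa i in ex_intro _ x e).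
have [|x xa] := pf _ _ _ Sr a'; first by exists b => i; rewrite ba /= a'E.
exists (f \o x) => [j|i]; first by exists (x j).
by rewrite (solves_linear f xa) /= a'E.
Qed.

Lemma range_submodule A B (f : {linear A -> B}) : submodule (range f).
Proof.
split; first by exists 0; rewrite ?linear0.
by move=> r _ _ [x _ <-] [y _ <-]; exists (r *: x + y); rewrite ?linearP.
Qed.

End Purity.
End Modules.
Arguments submP {R U S HS x}.

(** * Internal direct sums *)

Section InternalSum.
Variables (R : pzRingType) (U : lmodType R) (I : choiceType).
Implicit Types (F : I -> submodClosed U) (D : set I) (f g : I -> U).

(** The elements of a direct sum of submodules of [U] are represented by plain
    functions into [U] with finite support, which avoids dependent types. *)
Definition fsum f : U := \sum_(i \in [set: I]) f i.

Definition fin_supp f := finite_set [set i | f i <> 0].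

Lemma fsum_seq f (s : seq I) : uniq s -> (forall i, f i <> 0 -> i \in s) ->
  fsum f = \sum_(i <- s) f i.
Proof.
move=> us fs; rewrite /fsum (fsbigE s) //=.
  by apply: eq_bigl => i; apply/mem_set.
by move=> i _ /negP is0; apply: contrapT => /fs.
Qed.

Lemma fin_cover f : fin_supp f -> exists2 s, uniq s & forall i, f i <> 0 -> i \in s.
Proof.
move=> /finite_seqP[s sE]; exists (undup s); first exact: undup_uniq.
by move=> i fi; rewrite mem_undup; move/seteqP: sE => [/(_ i fi)].
Qed.

Lemma fin_seq f (s : seq I) : (forall i, f i <> 0 -> i \in s) -> fin_supp f.
Proof.
by move=> fs; apply: (@sub_finite_set _ _ [set` s]) => [i /fs//|]; apply: finite_seq.
Qed.

Lemma fsum_lin (J : eqType) (js : seq J) (r : J -> R) (f : J -> I -> U) :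
  (forall j, fin_supp (f j)) ->
  fin_supp (fun i => \sum_(j <- js) r j *: f j i) /\
  fsum (fun i => \sum_(j <- js) r j *: f j i) = \sum_(j <- js) r j *: fsum (f j).
Proof.
move=> ff.
have [s us sf] : exists2 s, uniq s &
    {in js, forall j i, f j i <> 0 -> i \in s}.
  elim: js => [|j js [s us sf]]; first by exists [::].
  have [t ut tf] := fin_cover (ff j).
  exists (undup (s ++ t)) => [|k]; first exact: undup_uniq.
  rewrite inE => /orP[/eqP->|kjs] i fk; rewrite mem_undup mem_cat.
    by rewrite (tf _ fk) orbT.
  by rewrite (sf k).
have cover i : \sum_(j <- js) r j *: f j i <> 0 -> i \in s.
  move=> ne0; apply: contrapT => is0; apply: ne0.
  apply: big1_seq => j /= jjs.
  have [->|fj] := pselect (f j i = 0); first by rewrite scaler0.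
  by case: is0; apply: sf fj.
split; first exact: fin_seq cover.
rewrite (fsum_seq us cover) exchange_big /=.
apply: eq_big_seq => j jjs; rewrite -scaler_sumr (@fsum_seq (f j) s) //.
exact: sf.
Qed.

Lemma fsum_comb (r : R) f g : fin_supp f -> fin_supp g ->
  fin_supp (fun i => r *: f i + g i) /\
  fsum (fun i => r *: f i + g i) = r *: fsum f + fsum g.
Proof.
move=> ff fg.
have := @fsum_lin bool [:: true; false] (fun b => if b then r else 1)
  (fun b => if b then f else g)
  (fun b => if b return fin_supp (if b then f else g) then ff else fg).
have -> : (fun i => \sum_(j <- [:: true; false])
    (if j then r else 1) *: (if j then f else g) i) = (fun i => r *: f i + g i).
  by apply/funext => i; rewrite !big_cons big_nil scale1r addr0.
by rewrite !big_cons big_nil scale1r addr0.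
Qed.

Lemma fsum_support1 f i : (forall k, k <> i -> f k = 0) -> fsum f = f i.
Proof.
move=> f0; rewrite (@fsum_seq _ [:: i]) ?big_seq1// => k fk.
by rewrite inE; apply/eqP; apply: contrapT => /f0.
Qed.

Definition fam F f := (forall i, f i \in F i) /\ fin_supp f.

Definition isum F : set U := [set x | exists2 f, fam F f & x = fsum f].

Definition indep F := forall f, fam F f -> fsum f = 0 -> forall i, f i = 0.

Lemma fam_comb F r f g : fam F f -> fam F g -> fam F (fun i => r *: f i + g i).
Proof.
move=> [fF ff] [gF fg]; split; last by have [] := fsum_comb r ff fg.
by move=> i; rewrite rpredD ?rpredZ.
Qed.

Lemma isum_submodule F : submodule (isum F).
Proof.
split.
  exists (fun=> 0).
    split; first by move=> i; exact: rpred0.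
    by apply: (@fin_seq _ [::]).
  by rewrite (@fsum_seq _ [::]) ?big_nil.
move=> r _ _ [f Ff ->] [g Fg ->].
exists (fun i => r *: f i + g i); first exact: fam_comb.
by have [_ ->] := fsum_comb r (proj2 Ff) (proj2 Fg).
Qed.

Lemma isum_member F i x : x \in F i -> isum F x.
Proof.
move=> xF; exists (fun k => if k == i then x else 0); last first.
  rewrite (@fsum_support1 _ i) ?eqxx// => k ki.
  by case: eqP.
split; first by move=> k; case: eqP => [->//|_]; exact: rpred0.
by apply: (@fin_seq _ [:: i]) => k; rewrite inE; case: eqP.
Qed.

Lemma isum_sub F (N : set U) : submodule N ->
  (forall i x, x \in F i -> N x) -> isum F `<=` N.
Proof.
move=> Ns FN _ [f [fF ff] ->]; have [s us sf] := fin_cover ff.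
rewrite (fsum_seq us sf).
by apply: submodule_sum => // i; apply: FN (fF i).
Qed.

Lemma indep_inj F f g : indep F -> fam F f -> fam F g ->
  fsum f = fsum g -> f = g.
Proof.
move=> iF Ff Fg e; apply/funext => i; apply/eqP; rewrite -subr_eq0 addrC -scaleN1r.
apply/eqP; apply: (iF (fun i => -1 *: g i + f i)) => //.
  exact: fam_comb.
have [_ ->] := fsum_comb (-1) (proj2 Fg) (proj2 Ff).
by rewrite scaleN1r e addNr.
Qed.

Lemma zero_submodule : submodule [set 0 : U].
Proof. by split=> // r x y -> ->; rewrite scaler0 addr0. Qed.

Definition zero_sub : submodClosed U := subm zero_submodule.

(** Subfamilies are obtained by replacing the other members by 0, so that all
    the families have the same index set. *)
Definition cut D F i : submodClosed U := if `[< D i >] then F i else zero_sub.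

Lemma cut_in D F i : D i -> cut D F i = F i.
Proof. by move=> Di; rewrite /cut asboolT. Qed.

Lemma cutP D F i x : x \in cut D F i <-> x = 0 \/ D i /\ x \in F i.
Proof.
rewrite /cut; case: asboolP => [Di|nDi]; split.
- by move=> xF; right.
- by case=> [->|[]//]; exact: rpred0.
- by move=> /submP; left.
- by case=> [->|[]//]; exact: rpred0.
Qed.

Lemma fam_cut D F f : fam (cut D F) f <-> fam F f /\ (forall i, f i <> 0 -> D i).
Proof.
split=> [[fF ff]|[[fF ff] fD]].
  split; first (split=> // i); last first.
    by move=> i fi; case/cutP: (fF i) => [//|[]].
  by case/cutP: (fF i) => [->|[]//]; exact: rpred0.
split=> // i; apply/cutP; have [->|fi] := pselect (f i = 0); first by left.
by right; split=> //; apply: fD.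
Qed.

Lemma indep_cut D F : indep F -> indep (cut D F).
Proof. by move=> iF f /fam_cut[Ff _]; apply: iF. Qed.

Lemma isum_cut D F : isum (cut D F) `<=` isum F.
Proof. by move=> _ [f /fam_cut[Ff _] ->]; exists f. Qed.

(** A finite support is contained in one member of the chain of index sets. *)
Lemma fam_cut_chain (DD : set (set I)) F f :
  DD !=set0 -> total_on DD subset -> fam (cut (\bigcup_(D in DD) D) F) f ->
  exists2 D, DD D & fam (cut D F) f.
Proof.
move=> [D0 DD0] tot /fam_cut[Ff fD]; have [s us sf] := fin_cover (proj2 Ff).
have [D DDD Ds] : exists2 D, DD D & {in s, forall i, f i <> 0 -> D i}.
  elim: s {us sf} => [|i s [D DDD Ds]]; first by exists D0.
  have [fi|/fD[D' DDD' D'i]] := pselect (f i = 0).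
    by exists D => // j; rewrite inE => /orP[/eqP->//|/Ds].
  have [DD'|D'D] := tot D D' DDD DDD'.
    exists D' => // j; rewrite inE => /orP[/eqP->//|js] fj.
    exact/DD'/Ds.
  by exists D => // j; rewrite inE => /orP[/eqP-> _|/Ds//]; apply: D'D.
by exists D => //; apply/fam_cut; split=> // i fi; apply: Ds => //; apply: sf.
Qed.

Lemma fam_cutU1 D F k f : fam (cut (D `|` [set k]) F) f -> ~ D k ->
  exists2 g, fam (cut D F) g &
    fsum f = fsum g + f k /\ forall i, i <> k -> f i = g i.
Proof.
move=> /fam_cut[[fF ff] fD] nDk.
pose g i := if i == k then 0 else f i.
pose d i := if i == k then f k else 0.
have gfam : fam (cut D F) g.
  apply/fam_cut; split; first split=> [i|].
  - by rewrite /g; case: eqP => _ //; exact: rpred0.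
  - by apply: sub_finite_set ff => i /=; rewrite /g; case: eqP.
  - by move=> i; rewrite /g; case: eqP => // ik /fD[].
exists g => //; split=> [|i /eqP/negPf ik]; last by rewrite /g ik.
have fd : fin_supp d by apply: (@fin_seq _ [:: k]) => i; rewrite inE /d; case: eqP.
have [_] := fsum_comb 1 fd (proj2 gfam).
rewrite scale1r (@fsum_support1 d k) => [|i ik]; last by rewrite /d; case: eqP.
rewrite {2}/d eqxx addrC => <-; congr fsum; apply/funext => i.
by rewrite scale1r /d /g; case: eqP => [->|_]; rewrite ?addr0 ?add0r.
Qed.

(** A partial sum is a direct summand of an independent sum: by independence a
    system may be solved componentwise, and the components of the solution with
    an index outside [D] may be dropped. *)
Lemma isum_cut_pure Sig D F : indep F -> pure_in Sig (isum (cut D F)) (isum F).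
Proof.
move=> iF m n r _ a aD [b bF ba].
have [f fP] := choice (fun i => let: ex_intro2 f p e := aD i in
  ex_intro (fun f => fam (cut D F) f /\ a i = fsum f) f (conj p e)).
have [g gP] := choice (fun j => let: ex_intro2 f p e := bF j in
  ex_intro (fun f => fam F f /\ b j = fsum f) f (conj p e)).
have coord i k : \sum_j r i j *: g j k = f i k.
  have gfin j : fin_supp (g j) by have [[]] := gP j.
  have [Hf Ht] := fsum_lin (index_enum _) (r i) gfin.
  have Ff : fam F (f i) by have [/fam_cut[]] := fP i.
  suff E : (fun k => \sum_j r i j *: g j k) = f i by rewrite -E.
  apply: (indep_inj iF) => //.
    split=> // k'; apply: (submodule_sum _ (submodule_mem _)) => j /=.
    by rewrite rpredZ//; have [[]] := gP j.
  rewrite Ht -(proj2 (fP i)) -ba.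
  by apply: eq_bigr => j _; rewrite (proj2 (gP j)).
pose h j k := if `[< D k >] then g j k else 0.
have hfam j : fam (cut D F) (h j).
  apply/fam_cut; have [[gF gfin] _] := gP j; split.
    split; first by move=> k; rewrite /h; case: ifP => // _; exact: rpred0.
    by apply: sub_finite_set gfin => k /=; rewrite /h; case: ifP.
  by move=> k; rewrite /h; case: asboolP.
exists (fun j => fsum (h j)) => [j|i]; first by exists (h j).
have [_ <-] := fsum_lin (index_enum _) (r i) (fun j => proj2 (hfam j)).
rewrite (proj2 (fP i)); congr fsum; apply/funext => k.
have [Dk|nDk] := pselect (D k).
  by rewrite -coord; apply: eq_bigr => j _; rewrite /h asboolT.
have -> : f i k = 0.
  by apply: contrapT => fik; apply: nDk; have [/fam_cut[_ H] _] := fP i; exact: H.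
by apply: big1 => j _; rewrite /h asboolF// scaler0.
Qed.

End InternalSum.

(** * Hulls of bounded size *)

Section SkolemHull.
Variables (O : smallType) (ar out : O -> smallType).

(** An operation [o] takes a family of arguments indexed by [ar o], maybe
    infinite, and yields a family of values indexed by [out o]; the value with
    index [j] is denoted by the term [App j args]. *)
Inductive terms : smallType := App (o : O) of out o & (ar o -> terms).

(** The downward Loewenheim-Skolem argument. Each requirement [Q o a y] on the
    values [y] given the arguments [a] is met by a choice function, and the
    values of the terms built from these functions form a subset that meets
    every requirement that is met in [N]. This subset is the image of a type
    that depends neither on [V] nor on [N] nor on [Q]. *)
Lemma skolem_hull (V : Type) (N : set V)
    (Q : forall o, (ar o -> V) -> (out o -> V) -> Prop) :
  N !=set0 ->
  exists2 e : terms -> V, forall t, N (e t) &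
    forall o (a : ar o -> V), (forall x, range e (a x)) ->
      (exists2 y, forall j, N (y j) & Q o a y) ->
      exists2 y, forall j, range e (y j) & Q o a y.
Proof.
move=> [z Nz].
pose good o a y := (forall j, N (y j)) /\
  ((exists2 y, forall j, N (y j) & Q o a y) -> Q o a y).
have sk o (a : ar o -> V) : exists y, good o a y.
  have [[y Ny Qy]|nQ] := pselect (exists2 y, forall j, N (y j) & Q o a y).
    by exists y.
  by exists (fun=> z); split=> // /nQ.
have [f fP] : exists f : forall o, (ar o -> V) -> out o -> V,
    forall o a, good o a (f o a).
  exists (fun o a => projT1 (cid (sk o a))) => o a.
  exact: projT2 (cid (sk o a)).
pose fix e (t : terms) : V :=
  match t with App o j s => f o (fun x => e (s x)) j end.
exists e; first by case=> o j s /=; have [] := fP o (fun x => e (s x)).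
move=> o a ae Qex.
have ae' x : exists t, e t = a x by have [t _ <-] := ae x; exists t.
have [s sE] := choice ae'.
have aE : (fun x => e (s x)) = a by apply/funext.
exists (f o a); last by have [_ /(_ Qex)] := fP o a.
by move=> j; exists (App j s) => //=; rewrite aE.
Qed.
End SkolemHull.

Section SmallHull.
Variables (R : pzRingType) (Sig : forall m n, 'M[R]_(m, n) -> Prop).

(** The operations that generate small pure submodules: the given point, linear
    combinations, solutions of systems in a submodule [A], and solutions of
    systems modulo [A]. *)
Inductive hull_op : smallType :=
  | Point
  | Comb of R
  | Solve m n of 'M[R]_(m, n)
  | SolveMod m n of 'M[R]_(m, n).

Definition hull_ar (o : hull_op) : smallType :=
  match o with
  | Point => void | Comb _ => bool
  | Solve m _ _ => 'I_m | SolveMod m _ _ => 'I_m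
  end.

Definition hull_out (o : hull_op) : smallType :=
  match o with
  | Point => unit | Comb _ => unit
  | Solve _ n _ => 'I_n | SolveMod _ n _ => 'I_n
  end.

Definition hull_terms : smallType := terms hull_ar hull_out.

Definition hull_spec (V : lmodType R) (A : set V) (b : V) (o : hull_op) :
    (hull_ar o -> V) -> (hull_out o -> V) -> Prop :=
  match o with
  | Point => fun _ y => y tt = b
  | Comb r => fun a y => y tt = r *: a true + a false
  | Solve m n r => fun a y => (forall j, A (y j)) /\ solves r y a
  | SolveMod m n r => fun a y => forall i, A (a i - \sum_j r i j *: y j)
  end.

Definition hull_closed (V : lmodType R) (N A : set V) (b : V) (S : set V) :=
  forall (o : hull_op) (a : hull_ar o -> V), (forall x, S (a x)) ->
    (exists2 y, forall j, N (y j) & hull_spec A b a y) ->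
    exists2 y, forall j, S (y j) & hull_spec A b a y.

Lemma hull_closed_submodule (V : lmodType R) (N A : set V) (b : V) (S : set V) :
  submodule N -> N b -> S `<=` N -> hull_closed N A b S -> submodule S /\ S b.
Proof.
move=> Ns Nb SN SP.
have Sb : S b.
  have [||y yS <-] := SP Point (fun x : void => match x with end) => //.
  by exists (fun=> b).
have SD r x y : S x -> S y -> S (r *: x + y).
  move=> Sx Sy.
  have [||z zS <-] := SP (Comb r) (fun t : bool => if t then x else y) => //.
    by case.
  exists (fun=> r *: x + y) => // _.
  by case: Ns => _; apply; apply: SN.
split=> //; split=> //; rewrite -(addNr b) -scaleN1r; exact: SD.
Qed.

Lemma hull_closed_solve (V : lmodType R) (N A : set V) (b : V) (S : set V) :
  A `<=` N -> hull_closed N A b S ->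
  forall m n (r : 'M[R]_(m, n)) (a : 'I_m -> V), (forall i, S (a i)) ->
    (exists2 x, forall j, A (x j) & solves r x a) ->
    exists2 x, forall j, (A `&` S) (x j) & solves r x a.
Proof.
move=> AN SP m n r a aS [x Ax xa].
have [||y yS [Ay ya]] := SP (Solve r) a => //; last by exists y.
by exists x => // j; apply: AN.
Qed.

Definition addset (V : lmodType R) (A B : set V) : set V :=
  [set x | exists a b, [/\ A a, B b & x = a + b]].

(** The hull [H] of [b] makes [A `&` H] pure, because solutions in [A] are
    available in [H], and [H / (A `&` H)] pure in [V / A], because solutions
    modulo [A] are available in [H]. The latter together with the purity of
    [A], or of [A `&` H], yields the purity of [A + H], or of [H]: given a
    system over [A + H], subtract a solution in [H] modulo [A]; the constants
    that remain are in [A]. *)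
Lemma small_hull (V : lmodType R) (A : set V) (b : V) :
  submodule A -> pure_in Sig A setT ->
  exists2 e : hull_terms -> V, submodule (range e) /\ range e b &
    [/\ pure_in Sig (A `&` range e) setT, pure_in Sig (range e) setT
      & pure_in Sig (addset A (range e)) setT].
Proof.
move=> As pA.
have [|e _ eP] := @skolem_hull _ hull_ar hull_out V setT (@hull_spec V A b).
  by exists 0.
have [es eb] : submodule (range e) /\ range e b.
  exact: hull_closed_submodule eP.
have eS := @hull_closed_solve V setT A b _ (fun _ _ => I) eP.
have eM m n (r : 'M[R]_(m, n)) (a : 'I_m -> V) : (forall i, range e (a i)) ->
    (exists x, forall i, A (a i - \sum_j r i j *: x j)) ->
    exists2 x, forall j, range e (x j) &
      forall i, A (a i - \sum_j r i j *: x j).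
  by move=> ae [x Ax]; apply: (eP (SolveMod r) a) => //; exists x.
have pAe : pure_in Sig (A `&` range e) setT.
  move=> m n r Sr a Ae b' /=.
  by apply: eS => [i|]; [have [] := Ae i|apply: pA b' => // i; have [] := Ae i].
have pe : pure_in Sig (range e) setT.
  move=> m n r Sr a ae [x _ xa].
  have [|y ye yA] := eM _ _ r a ae.
    by exists x => i; rewrite xa subrr; case: As.
  have [||z zAe za] := pAe _ _ _ Sr (fun i => a i - \sum_j r i j *: y j).
  - move=> i; split; first exact: yA.
    apply: submoduleB => //; apply: submodule_sum => // j.
    exact: submoduleZ.
  - by exists (fun j => x j - y j) => //; apply: solvesB.
  exists (fun j => z j + y j) => [j|i].
    by apply: submoduleD => //; have [] := zAe j.
  by rewrite (solvesD za (fun=> erefl)) subrK.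
exists e; first by split.
split=> //.
move=> m n r Sr c cAe [x _ xc].
have [a aP] := choice cAe; have [d adP] := choice aP.
have [||y ye yA] := eM _ _ r d.
- by move=> i; have [] := adP i.
- exists x => i; rewrite xc; have [Aa _ ->] := adP i.
  by rewrite opprD addrCA subrr addr0 -scaleN1r; apply: submoduleZ.
have [||z Az za] := pA _ _ _ Sr (fun i => c i - \sum_j r i j *: y j).
- move=> i; have [Aa _ ->] := adP i.
  by rewrite -addrA; apply: submoduleD.
- by exists (fun j => x j - y j) => //; apply: solvesB.
exists (fun j => z j + y j) => [j|i]; first by exists (z j), (y j).
by rewrite (solvesD za (fun=> erefl)) subrK.
Qed.
End SmallHull.

Section InjTerms.
Variable R : pzRingType.

(** The operations that generate small injective submodules. Besides those of
    [hull_op], each extension problem along an inclusion of submodules [A0] of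
    [B0], where [B0] is the image of a map [e] defined on [hull_terms R],
    yields an operation. As such problems have to form a small type, [B0] is
    coded by the relation [e t'' = r *: e t + e t'] between terms, and [A0] by
    the set of the terms that denote an element of it. *)
Inductive inj_op : smallType :=
  | Hull of hull_op R
  | Extend of (hull_terms R -> R -> hull_terms R -> hull_terms R -> Prop)
            & (hull_terms R -> Prop).

Definition inj_ar (o : inj_op) : smallType :=
  match o with Hull o => hull_ar o | Extend _ _ => hull_terms R end.

Definition inj_out (o : inj_op) : smallType :=
  match o with Hull o => hull_out o | Extend _ _ => hull_terms R end.

Definition inj_terms : smallType := terms inj_ar inj_out.

Definition inj_spec (V : lmodType R) (A : set V) (b : V) (o : inj_op) :
    (inj_ar o -> V) -> (inj_out o -> V) -> Prop :=
  match o with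
  | Hull o => @hull_spec R V A b o
  | Extend rel dom => fun a y =>
      (forall t r t' t'', rel t r t' t'' -> y t'' = r *: y t + y t') /\
      (forall t, dom t -> y t = a t)
  end.
End InjTerms.

(** * Relative injectivity *)

Section Relative.
Variables (R : pzRingType) (Sig : forall m n, 'M[R]_(m, n) -> Prop).
Variables (M : homClass R) (K : modClass R).
Hypothesis HM : forall (A B : lmodType R) (f : {linear A -> B}),
  M f <-> pure_map Sig f.
Hypotheses (Kdsum : closed_dsum K) (Ksub : closed_sub K M).
Hypothesis Kepi : closed_epi K M.
Implicit Types U V A B E : lmodType R.

Local Notation pure_in := (pure_in Sig).

(** An isomorphism is an epimorphism of the class, with kernel 0. *)
Lemma K_iso A B (f : {linear A -> B}) : bijective f -> K A -> K B.
Proof.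
move=> fbij; apply: (Kepi (f := f)).
exists (submodT (zero_sub A)), (inclusion (zero_sub A)); split; first split.
- exact: val_inj.
- apply/seteqP; split=> x /=.
    by move=> [[y yZ] _ <-] /=; move/submP: yZ => ->; rewrite linear0.
  move=> fx0; have x0 : x = 0 by apply: (bij_inj fbij); rewrite linear0.
  by exists 0.
- apply/seteqP; split=> // y _; have [g fK gK] := fbij.
  by exists (g y).
apply/HM/pure_map_inclusion; apply: (pure_in_retract (q := fun=> 0)) => //.
- by move=> r x y _ _; rewrite scaler0 addr0.
- by move=> x _; apply/submP.
- by move=> x /submP.
Qed.

Lemma le_subP U (S N : submodClosed U) :
  le_sub M S N <-> {subset S <= N} /\ pure_in [set` S] [set` N].
Proof.
split=> [[SN /HM/pure_map_incl]//|[SN pS]].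
by exists SN; apply/HM/pure_map_incl.
Qed.

Lemma K_pure_sub U (S N : submodClosed U) : {subset S <= N} ->
  pure_in [set` S] [set` N] -> K (submodT N) -> K (submodT S).
Proof. by move=> SN pS KN; apply: Ksub KN _; apply/le_subP. Qed.

(** Closure of [K] under submodules, for a map in place of an inclusion: the
    domain is isomorphic to the range. *)
Lemma K_pure A B (f : {linear A -> B}) : pure_map Sig f -> K B -> K A.
Proof.
move=> pf KB.
pose T := subm (submoduleT B); pose S := subm (range_submodule f).
have KT : K (submodT T).
  have [j jE] := @corestrict _ _ _ T (idfun : {linear B -> B}) (fun x => asboolT I).
  apply: (K_iso (f := j)) KB; exists (inclusion T) => x; first by rewrite /= jE.
  by apply: val_inj; rewrite jE.
have KS : K (submodT S).
  apply: K_pure_sub KT; first by move=> x _; apply/submP.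
  have := pure_map_range pf.
  have -> : [set` S] = range f by exact: subm_set.
  by apply: pure_in_sub.
have [j jE] : exists j : {linear A -> submodT S}, forall x, val (j x) = f x.
  by apply: corestrict => x; apply/submP; exists x.
have jbij : bijective j.
  apply: inj_surj_bij.
    by move=> x y /(congr1 val); rewrite !jE => /(proj1 pf).
  move=> [y yS]; have /submP[x _ xy] := yS.
  by exists x; apply: val_inj; rewrite jE.
have [g jK gK] := linear_bij_inv jbij.
by apply: (K_iso (f := g)) KS; exists j.
Qed.

Lemma rel_inj_retract E E' (i : {linear E' -> E}) (p : {linear E -> E'}) :
  cancel i p -> rel_injective K M E -> rel_injective K M E'.
Proof.
move=> iK [KE injE]; split; first exact: K_pure (pure_map_split Sig iK) KE.
move=> A B f KA KB Mf g.
have [h hf] := injE A B f KA KB Mf (i \o g).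
by exists (p \o h) => x /=; rewrite -[RHS]iK -[i _]hf.
Qed.

Lemma rel_inj_iso E E' (f : {linear E -> E'}) :
  bijective f -> rel_injective K M E -> rel_injective K M E'.
Proof. by move=> /linear_bij_inv[g fK gK]; apply: rel_inj_retract gK. Qed.

Definition sub_injective (U : lmodType R) (N : submodClosed U) :=
  rel_injective K M (submodT N).

Definition extension (U : lmodType R) (N : submodClosed U)
    (B : lmodType R) (A : set B) :=
  forall g : B -> U, linear_on A g -> (forall x, A x -> g x \in N) ->
  exists2 h : {linear B -> U}, forall x, h x \in N & {in A, h =1 g}.

(** Injectivity of a submodule [N] of [U] can be expressed by partial linear
    maps into [U], without any subtype: every embedding is an inclusion up to
    the isomorphism with its range. *)
Lemma injP U (N : submodClosed U) :
  sub_injective N <-> K (submodT N) /\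
  forall (B : lmodType R) (A : set B),
    K B -> submodule A -> pure_in A setT -> extension N A.
Proof.
split=> [[KN injN]|[KN injN]]; split=> //.
  move=> B A KB As pA g glin gN.
  pose S := subm As.
  have SA : [set` S] = A by exact: subm_set.
  have pS : pure_map Sig (inclusion S) by apply/pure_map_inclusion; rewrite SA.
  have KS := K_pure pS KB.
  pose g1 (x : submodT S) : submodT N :=
    exist _ (g (val x)) (gN _ (elimT submP (valP x))).
  have g1lin : linear g1.
    move=> r x y; apply: val_inj; rewrite [RHS]linearP -[LHS]/(g _) linearP.
    by rewrite glin//; apply/submP; apply: valP.
  have [h hE] := injN _ _ _ KS KB (iffRL (HM _) pS) (mklin g1lin).
  exists (inclusion N \o h); first by move=> x; apply: valP.
  move=> x /set_mem Ax.
  have xS : x \in S by apply/submP.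
  exact: (congr1 val (hE (exist _ x xS))).
move=> A B f KA KB /HM pf g.
have [f_inj _] := pf.
have [k kE] : exists k : B -> A, forall x, k (f x) = x.
  exists (fun y => xget 0 [set x | f x = y]) => x.
  by apply: f_inj; apply: (@xgetPex _ 0 [set z | f z = f x]); exists x.
have [|x _|h hN hE] := injN B (range f) KB (range_submodule f)
  (pure_map_range pf) (inclusion N \o g \o k).
- move=> r _ _ [x _ <-] [y _ <-] /=.
  by rewrite -linearP !kE -[X in _ = _ *: X + _]/(inclusion N (g x))
     -[X in _ = _ + X]/(inclusion N (g y)) !linearP.
- exact: valP.
have [h' h'E] := corestrict hN.
exists h' => x; apply: val_inj; rewrite /= h'E hE /= ?kE//.
by apply/mem_set; exists x.
Qed.

Lemma sub_injective_eq U (N N' : submodClosed U) :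
  N =i N' -> sub_injective N -> sub_injective N'.
Proof.
move=> NN' /injP[KN injN]; apply/injP; split.
  apply: K_pure_sub KN; first by move=> x; rewrite NN'.
  by move=> m n r Sr a aN [b bN ba]; exists b => // j; rewrite /= -NN'; apply: bN.
move=> B A KB As pA g glin gN.
have [|h hN hE] := injN B A KB As pA g glin; first by move=> x /gN; rewrite NN'.
by exists h => // x; rewrite -NN'.
Qed.

Lemma inj_retract U (N C : submodClosed U) (q : U -> U) :
  {subset C <= N} -> linear_on [set` N] q -> (forall x, x \in N -> q x \in C) ->
  {in C, forall x, q x = x} -> sub_injective N -> sub_injective C.
Proof.
move=> CN qN NC qC /injP[KN injN]; apply/injP; split.
  apply: K_pure_sub KN => //.
  by apply: pure_in_retract qN NC qC; apply: submodule_mem.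
move=> B A KB As pA g glin gC.
have [|h hN hE] := injN B A KB As pA g glin; first by move=> x /gC/CN.
have lin : linear (q \o h).
  by move=> r x y /=; rewrite linearP qN//=.
exists (mklin lin) => [x|x xA]; first exact/NC/hN.
by rewrite mklinE /= hE// qC//; apply/gC/set_mem.
Qed.

(** The identity of [S] extends to [N]. *)
Lemma retraction U (S N : submodClosed U) :
  {subset S <= N} -> pure_in [set` S] [set` N] -> sub_injective S ->
  K (submodT N) ->
  exists q : U -> U, [/\ linear_on [set` N] q, forall x, x \in N -> q x \in S
    & {in S, forall x, q x = x}].
Proof.
move=> SN pS [KS injS] KN.
have Mi : M (incl SN) by apply/HM/pure_map_incl.
have [h hE] := injS _ _ _ KS KN Mi idfun.
exists (fun x => if insub x is Some y then val (h y) else 0); split.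
- move=> r x y xN yN /=.
  have zN : r *: x + y \in N by rewrite rpredD ?rpredZ.
  rewrite (insubT (fun x => x \in N) zN) (insubT (fun x => x \in N) xN)
    (insubT (fun x => x \in N) yN).
  have -> : Sub (r *: x + y) zN = r *: Sub x xN + Sub y yN :> submodT N.
    by apply: val_inj; rewrite linearP.
  by rewrite linearP -[LHS]/(inclusion S _) linearP.
- by move=> x xN; rewrite (insubT (fun x => x \in N) xN); apply: valP.
- move=> x xS; rewrite (insubT (fun x => x \in N) (SN _ xS)).
  have -> : Sub x (SN x xS) = incl SN (exist _ x xS) :> submodT N by apply: val_inj.
  by have /= -> := hE (exist _ x xS).
Qed.

(** The kernel [C] of a retraction [q] of [N] onto [S]; it is injective as a
    retract of [N]. *)
Lemma complement U (S N : submodClosed U) :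
  {subset S <= N} -> pure_in [set` S] [set` N] ->
  sub_injective S -> sub_injective N ->
  exists C : submodClosed U, [/\ {subset C <= N}, sub_injective C,
    forall x, x \in S -> x \in C -> x = 0,
    forall x, x \in N -> exists2 y, y \in S & x - y \in C
    & exists q : U -> U, [/\ linear_on [set` N] q, forall x, x \in N -> q x \in S,
         {in S, forall x, q x = x} & forall x, x \in C <-> x \in N /\ q x = 0]].
Proof.
move=> SN pS injS injN; have [q [qN qS qid]] := retraction SN pS injS (proj1 injN).
have Cs : submodule [set x | x \in N /\ q x = 0].
  split; first by split; [exact: rpred0|exact: linear_on0 (submodule_mem N) qN].
  move=> r x y [xN qx] [yN qy]; split; first by rewrite rpredD ?rpredZ.
  by rewrite qN// qx qy scaler0 addr0.
have CE x : x \in subm Cs <-> x \in N /\ q x = 0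
    by split=> [/submP//|H]; apply/submP.
exists (subm Cs); split.
- by move=> x /CE[].
- apply: (inj_retract (q := fun x => x - q x)) injN.
  + by move=> x /CE[].
  + move=> r x y xN yN; rewrite qN// scalerBr opprD !addrA.
    by congr (_ - _); rewrite -!addrA [y - _]addrC.
  + move=> x xN; apply/CE => /=; have qxN := SN _ (qS _ xN).
    split; first exact: submoduleB (submodule_mem N) _ _.
    by rewrite (linear_onB qN)// (qid (q x)) ?subrr//; apply: qS.
  + by move=> x /CE[_ ->]; rewrite subr0.
- by move=> x xS /CE[_]; rewrite qid.
- move=> x xN; exists (q x); first exact: qS.
  apply/CE; have qxN := SN _ (qS _ xN).
  split; first exact: submoduleB (submodule_mem N) _ _.
  by rewrite (linear_onB qN)// (qid (q x)) ?subrr//; apply: qS.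
- by exists q; split.
Qed.

(** * Sums and unions of chains of injective modules *)

Lemma isum_inj (U : lmodType R) (I : choiceType) (F : I -> submodClosed U) :
  noetherian K M -> (forall i, sub_injective (F i)) -> indep F ->
  sub_injective (subm (isum_submodule F)).
Proof.
move=> noeth injF iF.
pose E (i : I) : lmodType R := submodT (F i).
have injE : rel_injective K M (dsum E) by apply: noeth.
pose co (f : dsum E) (i : I) : U := val (val f i).
have coF f : fam F (co f).
  split; first by move=> i; apply: valP.
  have /asboolP := valP f; apply: sub_finite_set => i /= ne e.
  exact: ne (congr1 val e).
have colin r f g : co (r *: f + g) = fun i => r *: co f i + co g i.
  apply/funext => i.
  exact: (linearP (inclusion (F i)) r (val f i) (val g i)).
have slin : linear (fun f => fsum (co f)).
  move=> r f g; rewrite colin.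
  by have [_ ->] := fsum_comb r (proj2 (coF f)) (proj2 (coF g)).
have [s sE] := @corestrict _ _ _ (subm (isum_submodule F)) (mklin slin)
  (fun f => introT submP (ex_intro2 _ _ (co f) (coF f) erefl)).
apply: (rel_inj_iso (f := s)) injE; apply: inj_surj_bij.
  move=> f g /(congr1 val); rewrite !sE /= => e.
  have cfg := indep_inj iF (coF f) (coF g) e.
  apply: val_inj; apply: functional_extensionality_dep => i; apply: val_inj.
  by rewrite -[LHS]/(co f i) cfg.
move=> [x xS]; have /submP[f [fF ff] xf] := xS.
pose f' : dprod E := fun i => exist _ (f i) (fF i).
have ff' : f' \in @finsupp R I E.
  apply/asboolP; apply: sub_finite_set ff => i /= ne e.
  by apply: ne; apply: val_inj.
exists (exist _ f' ff'); apply: val_inj; rewrite sE /=.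
by rewrite xf.
Qed.

Lemma inj_zero (U : lmodType R) (N : submodClosed U) :
  sub_injective N -> sub_injective (zero_sub U).
Proof.
move=> injN; apply: (inj_retract (q := fun=> 0)) injN.
- by move=> x /submP ->; exact: rpred0.
- by move=> r x y _ _; rewrite scaler0 addr0.
- by move=> x _; exact: rpred0.
- by move=> x /submP.
Qed.

Section Chain.
(** Let [C] be a chain of injective modules, in which every inclusion is in the
    class [M]. Its union is injective: it is the direct sum of complements of
    the unions of the initial segments, taken in the next member of the chain. *)
Hypothesis noeth : noetherian K M.
Variables (U : lmodType R) (W : choiceType) (le : rel W).
Hypothesis wo : well_order le.
Variable C : W -> submodClosed U.
Hypothesis injC : forall i, sub_injective (C i).
Hypothesis leC : forall i j, le i j ->
  {subset C i <= C j} /\ pure_in [set` C i] [set` C j].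

(** The element 0 is adjoined for the sake of the empty set of indices. *)
Definition chain_union (D : set W) : set U :=
  [set x | x = 0 \/ exists2 j, D j & x \in C j].

Lemma chain_union_submodule D : submodule (chain_union D).
Proof.
split; first by left.
move=> r x y [->|[i Di xi]]; first by move=> Dy; rewrite scaler0 add0r.
move=> [->|[j Dj yj]]; right.
  by exists i => //; rewrite addr0 rpredZ.
have [ij|ji] := wo_total wo i j.
  by exists j => //; rewrite rpredD ?rpredZ//; apply: (proj1 (leC ij)).
by exists i => //; rewrite rpredD ?rpredZ//; apply: (proj1 (leC ji)).
Qed.

Lemma chain_unionE D : D !=set0 ->
  chain_union D = \bigcup_(j in D) [set` C j].
Proof.
move=> [i Di]; apply/seteqP; split=> x; last by move=> [j Dj xj]; right; exists j.
by move=> [->|[j Dj xj]]; [exists i => //=; exact: rpred0|exists j].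
Qed.

Lemma chain_directed D i j : D i -> D j -> exists k,
  [/\ D k, [set` C i] `<=` [set` C k] & [set` C j] `<=` [set` C k]].
Proof.
move=> Di Dj; have [ij|ji] := wo_total wo i j.
  by exists j; split=> //; apply: (proj1 (leC ij)).
by exists i; split=> //; apply: (proj1 (leC ji)).
Qed.

Lemma chain_union_pure D (N : set U) : submodule N ->
  (forall j, D j -> pure_in [set` C j] N) -> pure_in (chain_union D) N.
Proof.
move=> Ns pC; have [D0|/set0P/negP/negPn/eqP D0] := pselect (D !=set0).
  rewrite chain_unionE//; apply: pure_in_directed => // i j.
  exact: chain_directed.
apply: (pure_in_retract (q := fun=> 0)) => //.
- by move=> r x y _ _; rewrite scaler0 addr0.
- by move=> x _; left.
- by move=> x [->//|[j]]; rewrite D0.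
Qed.

Lemma pure_chain_union i : pure_in [set` C i] (chain_union setT).
Proof.
rewrite chain_unionE; last by exists i.
move=> m n r Sr a aC [b bC ba].
have [|||j _ bj] := @directed_fin _ U W setT (fun j => [set` C j]) n b.
- by exists i.
- by move=> j k; apply: chain_directed.
- by move=> k; have [j _ bj] := bC k; exists j.
have [ij|ji] := wo_total wo i j.
  by apply: (proj2 (leC ij)) => //; exists b.
by exists b => // k; apply: (proj1 (leC ji)); apply: bj.
Qed.

Let below i : set W := [set j | le j i /\ j <> i].

(** [N] is an injective complement in [C i] of the union of the preceding
    members of the chain. *)
Let piece i (N : submodClosed U) := [/\ {subset N <= C i}, sub_injective N,
  forall x, chain_union (below i) x -> x \in N -> x = 0
  & forall x, x \in C i -> exists2 y, chain_union (below i) y & x - y \in N].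

(** In a dependence relation between elements of the complements, the one with
    the greatest index is in the union of the preceding members of the chain,
    hence is 0. *)
Lemma chain_union_pieces (F : W -> submodClosed U) D :
  (forall j k, D j -> le k j -> D k) -> (forall j, D j -> piece j (F j)) ->
  W -> sub_injective (subm (chain_union_submodule D)).
Proof.
move=> Ddown FP i0.
have injF i : sub_injective (cut D F i).
  have [Di|nDi] := pselect (D i); first by rewrite cut_in//; have [] := FP i Di.
  by rewrite /cut asboolF//; apply: inj_zero (injC i0).
have indF : indep (cut D F).
  move=> f /fam_cut[[fF ff] fD] f0 i; apply: contrapT => fi.
  have [s us sf] := fin_cover ff.
  have [|m] := @wo_max_seq _ le [seq k <- s | f k != 0] wo.
    move=> s0; have : i \in [seq k <- s | f k != 0].
      by rewrite mem_filter sf// andbT; apply/eqP.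
    by rewrite s0.
  rewrite mem_filter => /andP[/eqP fm ms] mmax; apply: (fm).
  have [_ _ + _] := FP m (fD m fm); apply; last exact: fF.
  pose d k := if k == m then f m else 0.
  have fd : fin_supp d
    by apply: (@fin_seq _ _ _ _ [:: m]) => k; rewrite inE /d; case: eqP.
  have [fdf] := fsum_comb (-1) ff fd.
  have -> : fsum d = f m.
    rewrite (@fsum_support1 _ _ _ _ m) /d ?eqxx// => k km.
    by case: eqP.
  rewrite f0 scaler0 add0r => <-.
  have [t ut tf] := fin_cover fdf.
  rewrite (fsum_seq ut tf).
  apply: (submodule_sum _ (chain_union_submodule _)) => k.
  rewrite /d; case: (eqVneq k m) => [->|km].
    by left; rewrite scaleN1r addNr.
  have [fk|fk] := pselect (f k = 0); first by left; rewrite fk scaler0 addr0.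
  right; exists k.
    split; last exact/eqP.
    by apply: mmax; rewrite mem_filter sf// andbT; apply/eqP.
  have [FC _ _ _] := FP k (fD k fk).
  by rewrite addr0 rpredZ//; apply: FC.
have := isum_inj noeth injF indF; apply: sub_injective_eq => x.
apply/submP/submP; last first.
  case=> [->|[j Dj xj]]; first by have [] := isum_submodule (cut D F).
  elim/(wo_ind wo): j x Dj xj => j IH x Dj xj.
  have [_ _ _ /(_ x xj)[y yj xyF]] := FP j Dj.
  rewrite -[x](addrNK y); apply: submoduleD; first exact: isum_submodule.
    by apply: (@isum_member _ _ _ _ j); rewrite cut_in.
  case: yj => [y0|[k [kj nkj] yk]].
    by rewrite y0; have [] := isum_submodule (cut D F).
  exact: (IH k kj nkj y (Ddown j k Dj kj) yk).
apply: isum_sub; first exact: chain_union_submodule.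
move=> i y /cutP[->|[Di yF]]; first by left.
by right; exists i => //; have [FC _ _ _] := FP i Di; apply: FC.
Qed.

(** By induction on [i], the complement exists at [i]: the union of the
    preceding members is the sum of their complements, so it is injective. *)
Lemma chain_union_inj : W -> sub_injective (subm (chain_union_submodule setT)).
Proof.
move=> i0.
have [F FP] : exists F, forall i, (exists N, piece i N) -> piece i (F i).
  exact: (choice_on (fun=> zero_sub U) (fun i PN => PN)).
apply: (@chain_union_pieces F) => // j _; apply: (FP).
elim/(wo_ind wo): j => i IH.
have injV : sub_injective (subm (chain_union_submodule (below i))).
  apply: (@chain_union_pieces F) => //.
    move=> j k [ji nji] kj; split; first exact: wo_trans kj ji.
    by move=> ki; apply: nji; apply: (wo_anti wo ji); rewrite -ki.
  by move=> j [ji nji]; apply: FP; apply: IH.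
have VC : {subset subm (chain_union_submodule (below i)) <= C i}.
  move=> x /submP[->|[j [ji _] xj]]; first exact: rpred0.
  exact: (proj1 (leC ji)).
have [|N [NC injN VN CN _]] := complement VC _ injV (injC i).
  rewrite subm_set; apply: chain_union_pure; first exact: submodule_mem.
  by move=> j [ji _]; apply: (proj2 (leC ji)).
exists N; split=> // x.
  by move=> Vx; apply: VN; apply/submP.
by move=> /CN[y /submP Vy xyN]; exists y.
Qed.

End Chain.

(** * A Baer criterion *)

Definition small_extension (U : lmodType R) (N : submodClosed U) :=
  forall (B : lmodType R) (e : hull_terms R -> B) (A : set B),
    range e = setT -> K B -> submodule A -> pure_in A setT -> extension N A.

(** Take a maximal extension [phi] of [g] whose domain [D] is pure in [B], given by
    its graph [G]. If [b] is in [B], the restriction of [phi] to the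
    intersection of [D] and the hull [H] of [b] extends to [H]; gluing this
    extension with [phi] yields an extension to the pure submodule [D + H], so
    that [D] contains [b]. *)
Lemma baer (U : lmodType R) (N : submodClosed U) :
  K (submodT N) -> small_extension N -> sub_injective N.
Proof.
move=> KN smallN; apply/injP; split=> // B A KB As pA g glin gN.
pose dom (G : set (B * U)%type) : set B := [set x | exists u, G (x, u)].
pose P (G : set (B * U)%type) := [/\ submodule G,
  forall x u v, G (x, u) -> G (x, v) -> u = v,
  forall x u, G (x, u) -> u \in N & pure_in (dom G) setT].
pose G0 : set (B * U)%type := [set p | A p.1 /\ p.2 = g p.1].
have [||G [[Gs Gf GN pG] G0G Gmax]] := @Zorn_above _ P G0.
- split.
  + split; first by split; [case: As|rewrite (linear_on0 As glin)].
    move=> r [x u] [y v] /= [/= Ax ->] [/= Ay ->]; split=> /=.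
      by case: As => _; apply.
    by rewrite glin.
  + by move=> x u v [/= _ ->] [/= _ ->].
  + by move=> x u [/= Ax ->]; apply: gN.
  + suff -> : dom G0 = A by [].
    apply/seteqP; split=> x; first by move=> [u []].
    by move=> Ax; exists (g x).
- move=> F [H FH] FP Ftot.
  split.
  + split; first by exists H => //; have [[]] := FP H FH.
    move=> r p q Fp Fq; have [X [FX Xp Xq]] := chain_two Ftot Fp Fq.
    by exists X => //; have [[_ XD] _ _ _] := FP X FX; apply: XD.
  + move=> x u v Fu Fv; have [X [FX Xu Xv]] := chain_two Ftot Fu Fv.
    by have [_ Xf _ _] := FP X FX; apply: Xf Xu Xv.
  + by move=> x u [X FX Xu]; have [_ _ XN _] := FP X FX; apply: XN Xu.
  + have -> : dom (\bigcup_(X in F) X) = \bigcup_(X in F) dom X.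
      apply/seteqP; split=> x;
        first by move=> [u [X FX Xu]]; exists X => //; exists u.
      by move=> [X FX [u Xu]]; exists u, X.
    apply: pure_in_directed; first by exists H.
      move=> X Z FX FZ; have [XZ|ZX] := Ftot X Z FX FZ.
        by exists Z; split=> // x [u Xu]; exists u; apply: XZ.
      by exists X; split=> // x [u Xu]; exists u; apply: ZX.
    by move=> X FX; have [] := FP X FX.
have [phi phiP] := choice_on (fun=> 0) (fun x (Gx : dom G x) => Gx).
have phiE x u : G (x, u) -> u = phi x.
  by move=> Gu; exact: Gf Gu (phiP x (ex_intro _ u Gu)).
have doms : submodule (dom G).
  split; first by exists 0; case: Gs.
  move=> r x y [u Gu] [v Gv]; exists (r *: u + v).
  by case: Gs => _ GD; apply: (GD r (x, u) (y, v)).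
have philin : linear_on (dom G) phi.
  move=> r x y /phiP Gx /phiP Gy; apply/esym/phiE.
  by case: Gs => _ GD; apply: (GD r (x, phi x) (y, phi y)).
have domT b : dom G b.
  have [e [es eb] [pAe pe pDe]] := small_hull b doms pG.
  pose S := subm es; pose B0 : lmodType R := submodT S.
  have KB0 : K B0.
    apply: K_pure KB; apply/(pure_map_inclusion Sig S).
    by rewrite subm_set.
  have eS t : e t \in S by apply/submP; exists t.
  pose e0 t : B0 := exist _ (e t) (eS t).
  pose A0 : set B0 := [set x | dom G (val x)].
  have A0s : submodule A0.
    split; first by case: doms.
    by move=> r x y Ax Ay; case: doms => _; apply.
  have pA0 : pure_in A0 setT.
    move=> m n r Sr a Aa [x _ xa].
    have [||z zAe za] := pAe _ _ _ Sr (fun i => val (a i)).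
    - by move=> i; split; [apply: Aa|apply/submP/valP].
    - exists (fun j => val (x j)) => //.
      exact: (solves_linear (inclusion S) xa).
    have zS j : z j \in S by apply/submP; have [] := zAe j.
    exists (fun j => exist _ (z j) (zS j) : B0); first by move=> j; have [] := zAe j.
    exact: solves_val.
  have e0T : range e0 = setT.
    apply/seteqP; split=> // -[x xS] _; have /submP[t _ tx] := xS.
    by exists t => //; apply: val_inj.
  have [|x Ax|h hN hE] :=
    smallN B0 e0 A0 e0T KB0 A0s pA0 (fun x => phi (val x)).
  - by move=> r x y Ax Ay; rewrite linearP philin.
  - by apply: GN; apply: phiP.
  pose G' : set (B * U)%type := [set p | exists a (c : B0),
    [/\ dom G a, p.1 = a + val c & p.2 = phi a + h c]].
  suff -> : G = G'.
    exists (0 + h (exist _ b (introT submP eb))), 0.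
    exists (exist _ b (introT submP eb)).
    split; first by case: doms.
      by rewrite /= add0r.
    by rewrite /= (linear_on0 doms philin).
  apply/esym/Gmax; last first.
    move=> [x u] Gxu; exists x, 0; split; first by exists u.
      by rewrite linear0 addr0.
    by rewrite linear0 addr0; apply: phiE.
  split.
  - split.
      exists 0, 0; rewrite !linear0 !addr0; split=> //; first by case: doms.
      by rewrite (linear_on0 doms philin).
    move=> r [x u] [y v] [a [c [/= Ga -> ->]]] [a' [c' [/= Ga' -> ->]]].
    exists (r *: a + a'), (r *: c + c'); split => /=.
    + by case: doms => _; apply.
    + by rewrite -[X in _ = _ + X]/(inclusion S (r *: c + c')) linearP
        scalerDr addrACA.
    + by rewrite linearP philin// scalerDr addrACA.
  - move=> x u v [a [c [/= Ga -> ->]]] [a' [c' [/= Ga' e1 ->]]].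
    have e2 : a - a' = val (c' - c).
      rewrite linearB; apply/eqP; rewrite subr_eq addrAC.
      by rewrite (addrC _ a') -[X in _ == X - _]e1 addrK.
    have : h (c' - c) = phi (a - a').
      rewrite hE; first by rewrite e2.
      have : dom G (a - a') by apply: submoduleB.
      by rewrite e2 => ?; apply/mem_set.
    rewrite linearB (linear_onB philin)// => e3.
    move/eqP: e3; rewrite eq_sym subr_eq => /eqP ->.
    by rewrite addrAC subrK addrC.
  - move=> x u [a [c [/= Ga _ ->]]].
    by rewrite rpredD//; apply: GN; apply: phiP Ga.
  - have -> : dom G' = addset (dom G) (range e) => //.
    apply/seteqP; split=> x.
      move=> [u [a [c [/= Ga -> _]]]]; exists a, (val c); split=> //.
      exact/submP/valP.
    move=> [a [c [Ga ec ->]]].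
    exists (phi a + h (exist _ c (introT submP ec))), a.
    exists (exist _ c (introT submP ec)).
    by split.
have lin : linear phi by move=> r x y; apply: philin.
exists (mklin lin) => [x|x /set_mem Ax]; first by apply: GN; apply: phiP.
by rewrite mklinE; apply/esym/phiE/G0G.
Qed.

(** * Small injective submodules *)

(** Close the element under the operations of [inj_op]: the extension problems are
    solvable in [N], hence in the hull, which is therefore injective by the Baer
    criterion, and whose size is bounded by that of [inj_terms R]. *)
Lemma small_inj (U : lmodType R) (N : submodClosed U) (x : U) :
  sub_injective N -> x \in N ->
  exists (X : submodClosed U) (e : inj_terms R -> U),
    [/\ range e = [set` X], x \in X, {subset X <= N},
        pure_in [set` X] [set` N] & sub_injective X].
Proof.
move=> injN xN; have Ns := submodule_mem N.
have [KN extN] := iffLR (injP N) injN.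
have [|e eN eP] := @skolem_hull _ (@inj_ar R) (@inj_out R) U [set` N]
  (@inj_spec R U [set` N] x); first by exists x.
have hP : hull_closed [set` N] [set` N] x (range e).
  by move=> o; apply: (eP (Hull o)).
have esubN : range e `<=` [set` N] by move=> _ [t _ <-]; apply: eN.
have [es ex] := hull_closed_submodule Ns xN esubN hP.
have eS := hull_closed_solve (fun _ Nx => Nx) hP.
pose X := subm es.
have XE : [set` X] = range e by exact: subm_set.
have pX : pure_in [set` X] [set` N].
  rewrite XE => m n r Sr a ae [b bN ba].
  have [|y ye ya] := eS m n r a ae; first by exists b.
  by exists y => // j; have [] := ye j.
have XN : {subset X <= N} by move=> y /submP/esubN.
exists X, e; split=> //; first exact/submP.
apply: baer; first exact: K_pure_sub XN pX KN.
move=> B p A pT KB As pA g glin gX.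
have [|h hN hE] := extN B A KB As pA g glin; first by move=> y /gX/XN.
have psurj b : exists t, p t = b.
  by have [_ /(_ b I)[t _ <-]] := iffLR (seteqP _ _) pT; exists t.
pose rel t r t' t'' := p t'' = r *: p t + p t'.
have [||y ye [yrel yA]] := eP (Extend rel (fun t => A (p t)))
  (fun t => if `[< A (p t) >] then g (p t) else x).
- move=> t /=; case: asboolP => // Apt.
  exact: (elimT submP (gX _ Apt)).
- exists (fun t => h (p t)) => [t|]; first exact: hN.
  split=> [t r t' t''|t Apt]; first by rewrite /rel => ->; rewrite linearP.
  by rewrite asboolT// hE//; apply/mem_set.
(* The solution respects the coding relation, which makes it a function of the
   denoted element, and linear. *)
have [s sK] := choice psurj.
have [t0 pt0] := psurj 0.
have y0 : y t0 = 0.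
  have := yrel t0 (-1) t0 t0; rewrite scaleN1r addNr; apply.
  by rewrite /rel pt0 scaler0 addr0.
have yE t t' : p t = p t' -> y t = y t'.
  move=> e1; rewrite (yrel t' 1 t0 t) ?y0 ?addr0 ?scale1r//.
  by rewrite /rel pt0 addr0 scale1r.
have lin : linear (fun b => y (s b)).
  by move=> r b b'; apply: yrel; rewrite /rel !sK.
exists (mklin lin) => [b|b /set_mem Ab]; first by apply/submP; apply: ye.
by rewrite mklinE yA ?sK// asboolT.
Qed.

Section Decomposition.
Hypothesis noeth : noetherian K M.
Variables (U : lmodType R) (N : submodClosed U).
Hypothesis injN : sub_injective N.

Let I : choiceType := {classic submodClosed U}.
Let F (X : I) : submodClosed U := X.

Lemma inj_cut (J : choiceType) (D : set J) (G : J -> submodClosed U) :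
  (forall i, D i -> sub_injective (G i)) -> forall i, sub_injective (cut D G i).
Proof.
move=> injG i; have [Di|nDi] := pselect (D i);
  first by rewrite cut_in//; apply: injG.
by rewrite /cut asboolF//; apply: inj_zero injN.
Qed.

(** The sum [S] of a maximal independent family of small injective submodules
    with a pure sum is all of [N]. Indeed [S] is injective, so it has an
    injective complement [C], and a small injective submodule of [C] could be
    added to the family if [C] were not 0. *)
Lemma small_decomposition : exists D : set I,
  [/\ forall X, D X -> exists e : inj_terms R -> U, range e = [set` F X],
      forall X, D X -> sub_injective (F X), indep (cut D F)
    & isum (cut D F) = [set` N]].
Proof.
have Ns := submodule_mem N.
pose P (D : set I) := [/\ forall X, D X ->
    [/\ sub_injective (F X), {subset F X <= N}
      & exists e : inj_terms R -> U, range e = [set` F X]],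
  indep (cut D F) & pure_in (isum (cut D F)) [set` N]].
have [||D [[Dgood Dindep Dpure] _ Dmax]] := @Zorn_above _ P set0.
- split=> //.
    move=> f /fam_cut[_ f0] _ i; apply: contrapT => /f0[].
  apply: (pure_in_retract (q := fun=> 0)) => //.
  + by move=> r x y _ _; rewrite scaler0 addr0.
  + by move=> x _; have [] := isum_submodule (cut set0 F).
  + move=> x xs; suff -> : x = 0 by [].
    by apply: (isum_sub (zero_submodule U) _ xs) => X y /cutP[->|[]].
- move=> DD DD0 DP Dtot; split.
  + by move=> X [D DDD DX]; have [+ _ _] := DP D DDD; apply.
  + move=> f /(fam_cut_chain DD0 Dtot)[D DDD fD].
    by have [_ + _] := DP D DDD; apply.
  + have -> : isum (cut (\bigcup_(D in DD) D) F) =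
        \bigcup_(D in DD) isum (cut D F).
      apply/seteqP; split=> x.
        by move=> [f /(fam_cut_chain DD0 Dtot)[D DDD fD] ->]; exists D => //; exists f.
      move=> [D DDD [f /fam_cut[Ff fD] ->]]; exists f => //.
      by apply/fam_cut; split=> // i /fD Di; exists D.
    apply: pure_in_directed => //; last by move=> D /DP[].
    have mono (D D' : set I) : D `<=` D' -> isum (cut D F) `<=` isum (cut D' F).
      move=> DD' _ [f /fam_cut[Ff fD] ->]; exists f => //.
      by apply/fam_cut; split=> // i /fD/DD'.
    move=> D D' DDD DDD'; have [DD'|D'D] := Dtot D D' DDD DDD'.
      by exists D'; split=> //; apply: mono.
    by exists D; split=> //; apply: mono.
have Dinj : forall X, D X -> sub_injective (F X) by move=> X /Dgood[].
have Dsmall X : D X -> exists e : inj_terms R -> U, range e = [set` F X].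
  by move=> /Dgood[].
exists D; split=> //.
pose S := subm (isum_submodule (cut D F)).
have SE : [set` S] = isum (cut D F) by exact: subm_set.
have injS : sub_injective S by apply: isum_inj => //; apply: inj_cut.
have SN : {subset S <= N}.
  move=> x /submP xs; apply: (isum_sub Ns _ xs) => X y /cutP[->|[/Dgood[_ XN _]]].
    exact: rpred0.
  exact: XN.
have pS : pure_in [set` S] [set` N] by rewrite SE.
have [C [CN injC SC NSC [q [qN qS qid CE]]]] := complement SN pS injS injN.
rewrite -SE; apply/seteqP; split=> // x xN; apply: contrapT => xS.
have [y yS xyC] := NSC x xN.
have [X [e [eX xyX XC pX injX]]] := small_inj injC xyC.
have xy0 : x - y <> 0.
  by move=> /eqP; rewrite subr_eq0 => /eqP xy; apply: xS; rewrite /= xy.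
have nDX : ~ D X.
  move=> DX; apply: xy0; apply: SC => //; apply/submP.
  have xyF : x - y \in cut D F X by rewrite cut_in.
  exact: isum_member xyF.
suff DE : D `|` [set (X : I)] = D by apply: nDX; rewrite -DE; right.
apply: Dmax; last by left.
split.
- move=> Y [/Dgood//|->]; split=> //; last by exists e.
  by move=> z /XC/CN.
- move=> f fD fT0 i; have [g gD [fT fg]] := fam_cutU1 fD nDX.
  have fX : f (X : I) \in F X by have /fam_cut[[]] := fD.
  have fX0 : f (X : I) = 0.
    apply: SC (XC _ fX); apply/submP.
    have -> : f (X : I) = - fsum g.
      by apply/eqP; rewrite eq_sym -subr_eq0 -opprD oppr_eq0 -fT fT0.
    rewrite -scaleN1r; apply: submoduleZ; first exact: isum_submodule.
    by exists g.
  have [->//|iX] := pselect (i = X).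
  by rewrite fg//; apply: (Dindep g) => //; move: fT; rewrite fT0 fX0 addr0.
(* The purity of [S + X] follows from that of [S] and of [X] in the summands
   [S] and [C] of [N]. *)
- move=> m n r Sr a aD [b bN ba].
  have Xin z : z \in X -> isum (cut (D `|` [set (X : I)]) F) z.
    move=> zX; have zF : z \in cut (D `|` [set (X : I)]) F X.
      by rewrite cut_in//; right.
    exact: isum_member zF.
  have Sin z : z \in S -> isum (cut (D `|` [set (X : I)]) F) z.
    move=> /submP[f /fam_cut[Ff fD] ->]; exists f => //.
    by apply/fam_cut; split=> // i /fD Di; left.
  have qC z : z \in N -> z - q z \in C.
    move=> zN; have qzN := SN _ (qS _ zN).
    apply/CE; split; first exact: (submoduleB Ns zN qzN).
    by rewrite (linear_onB qN)// (qid (q z)) ?subrr//; apply: qS.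
  have aSX i : exists2 z, z \in X & q (a i) = a i - z /\ a i - z \in S.
    have [f fD ->] := aD i; have [g gD [-> _]] := fam_cutU1 fD nDX.
    have fX : f (X : I) \in X by have /fam_cut[[+ _ _]] := fD; apply.
    have gS : fsum g \in S by apply/submP; exists g.
    exists (f (X : I)) => //; rewrite addrK; split=> //.
    have [fXN qfX] := iffLR (CE _) (XC _ fX).
    rewrite -[fsum g]scale1r qN//=; last exact: SN.
    by rewrite qfX addr0 qid.
  have aN i : a i \in N.
    have [z zX [_ azS]] := aSX i.
    by rewrite -(subrK z (a i)) rpredD//; [exact/SN|exact/CN/XC].
  have [||z zX za] := pX _ _ _ Sr (fun i => a i - q (a i)).
  - by move=> i; have [z zX [-> _]] := aSX i; rewrite /= opprB addrC subrK.
  - exists (fun j => b j - q (b j)); first by move=> j; apply/qC/bN.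
    exact: (solvesB ba (solves_linear_on Ns qN bN ba)).
  exists (fun j => z j + q (b j)) => [j|i].
    by apply: submoduleD; [exact: isum_submodule|exact/Xin/zX|exact/Sin/qS/bN].
  by rewrite (solvesD za (solves_linear_on Ns qN bN ba)) /= subrK.
Qed.

End Decomposition.

(** * The Loewenheim-Skolem-Tarski property *)

Lemma list_sum (V : zmodType) (X J : Type) (v : X -> V) (s : seq J) (f : J -> V) :
  (forall i, exists x, v x = f i) ->
  exists l : seq X, \sum_(x <- l) v x = \sum_(i <- s) f i.
Proof.
move=> vf; elim: s => [|i s [l lE]]; first by exists [::]; rewrite !big_nil.
by have [x xE] := vf i; exists (x :: l); rewrite !big_cons xE lE.
Qed.

Lemma card_le_inj (X Y : Type) (f : X -> Y) : injective f ->
  [set: X] #<= [set: Y].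
Proof.
move=> f_inj; have /injfunPex[g] : exists2 g : X -> Y,
    set_fun [set: X] [set: Y] g & set_inj [set: X] g.
  by exists f => // x y _ _; apply: f_inj.
exact: inj_card_le.
Qed.

Definition LST_bound : smallType := (nat + R + inj_terms R)%type.

(** Decompose [N] into small injective submodules. Each element of [A] has
    finitely many nonzero components; let [J] be the set of the indices of
    these, for all the elements of [A]. The sum of the members with an index in
    [J] is an injective summand of [N] that contains [A]. Its elements are
    denoted by the finite sequences of triples [(a, k, t)], for the element
    denoted by the term [t] in the [k]-th relevant component of [a]; there are
    no more of these than elements of the infinite set [A + LST_bound]. *)
Lemma lowenheim_skolem (U : lmodType R) (N : submodClosed U) (A : set U) :
  noetherian K M -> sub_injective N -> A `<=` [set` N] ->
  exists N0 : submodClosed U,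
    [/\ sub_injective N0, {subset N0 <= N} /\ pure_in [set` N0] [set` N],
        A `<=` [set` N0]
      & [set: submodT N0] #<= [set: (A + LST_bound)%type]].
Proof.
move=> noeth injN AN.
have [D [Dsmall Dinj Dindep DN]] := small_decomposition noeth injN.
pose I : choiceType := {classic submodClosed U}.
pose F (X : I) : submodClosed U := X; pose G := cut D F.
have dec (a : A) : exists f : I -> U, fam G f /\ val a = fsum f.
  have : isum G (val a) by rewrite DN; apply/AN/set_mem/valP.
  by case=> f fG fE; exists f.
have [f fP] := choice dec.
have cov (a : A) : exists s : seq I, forall i, f a i <> 0 -> i \in s.
  by have [s _ sf] := fin_cover (proj2 (proj1 (fP a))); exists s.
have [s sP] := choice cov.
pose J : set I := [set i | exists a, f a i <> 0].
have JD : J `<=` D.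
  by move=> i [a fai]; have [/fam_cut[_ fD] _] := fP a; apply: fD fai.
have Gindep : indep (cut J G) := indep_cut Dindep.
exists (subm (isum_submodule (cut J G))); split.
- apply: isum_inj => //; apply: (inj_cut injN) => i Ji.
  by rewrite /G cut_in; [apply/Dinj/JD|apply: JD].
- split; first by move=> x /submP/isum_cut; rewrite DN.
  by rewrite subm_set -DN; apply: isum_cut_pure.
- move=> a Aa; have [fG aE] := fP (exist _ a (mem_set Aa)).
  apply/submP; exists (f (exist _ a (mem_set Aa))) => //.
  by apply/fam_cut; split=> // i fi; exists (exist _ a (mem_set Aa)).
have [e eE] : exists e : I -> inj_terms R -> U,
    forall X, D X -> range (e X) = [set` F X].
  exact: choice_on (fun _ _ => 0) Dsmall.
(* [None] stands for 0, the value of the components that vanish. *)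
pose v (p : option (A * nat * inj_terms R)) : U :=
  if p is Some (a, k, t) then e (nth (zero_sub U : I) (s a) k) t else 0.
have vsum (x : submodT (subm (isum_submodule (cut J G)))) :
    exists l, \sum_(p <- l) v p = val x.
  have /submP[g /fam_cut[[gG gfin] gJ] ->] := valP x.
  have [c uc gc] := fin_cover gfin.
  rewrite (fsum_seq uc gc); apply: list_sum => i.
  have [gi0|gi] := pselect (g i = 0); first by exists None.
  have [a fai] := gJ i gi; have is_a := sP a i fai.
  have Di : D i by apply: JD; exists a.
  have : range (e i) (g i) by rewrite eE//; have := gG i; rewrite /G cut_in.
  by case=> t _ te; exists (Some (a, index i (s a), t)); rewrite /v nth_index.
have [l lE] := choice vsum.
pose Y : eqType := {classic (A + LST_bound)%type}.
have [F0 F0_inj] : exists F0 : seq Y -> Y, injective F0.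
  by apply: (@seq_inj Y (fun n => inr (inl (inl n)))) => m n [].
pose code (p : option (A * nat * inj_terms R)) : seq Y :=
  if p is Some (a, k, t) then [:: inl a; inr (inl (inl k)); inr (inr t)]
  else [::].
have code_inj : injective code.
  by move=> [[[a k] t]|] [[[a' k'] t']|] //= [-> -> ->].
apply: (@card_le_inj _ _ (fun x => F0 (map (fun p => F0 (code p)) (l x)) : Y)).
move=> x y /F0_inj /(inj_map (fun p q => (@code_inj p q) \o (@F0_inj _ _))) lxy.
by apply: val_inj; rewrite -!lE lxy.
Qed.

(** * Direct sums of injective modules in an abstract elementary class *)

Lemma inj_sum (U : lmodType R) (N N1 N2 : submodClosed U) (q : {linear U -> U}) :
  K (submodT N) -> sub_injective N1 -> sub_injective N2 ->
  {subset N1 <= N} -> {subset N2 <= N} ->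
  (forall x, x \in N -> q x \in N1) -> (forall x, x \in N -> x - q x \in N2) ->
  sub_injective N.
Proof.
move=> KN /injP[_ ext1] /injP[_ ext2] N1N N2N qN1 qN2.
apply/injP; split=> // B A KB As pA g glin gN.
have [||h1 h1N h1E] := ext1 B A KB As pA (q \o g).
- by move=> r x y Ax Ay; rewrite /= glin// linearP.
- by move=> x Ax; apply/qN1/gN.
have [||h2 h2N h2E] := ext2 B A KB As pA (fun x => g x - q (g x)).
- by move=> r x y Ax Ay; rewrite glin// linearP scalerBr opprD addrACA.
- by move=> x Ax; apply/qN2/gN.
have lin : linear (fun x => h1 x + h2 x).
  by move=> r x y; rewrite !linearP scalerDr addrACA.
exists (mklin lin) => x.
  by rewrite mklinE rpredD//; [exact: N1N|exact: N2N].
by move=> Ax; rewrite mklinE h1E// h2E//= addrC subrK.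
Qed.

Section DirectSum.
(** The partial sums over the initial segments of a well-ordering of the index
    set form a chain; they are injective by induction, the chain axiom being
    used at the limit steps. All of them live in the direct product. *)
Hypothesis aec : is_AEC (rel_injective K M) (le_sub M).
Variables (I : smallType) (E : I -> lmodType R).
Hypothesis injE : forall i, rel_injective K M (E i).

Let U : lmodType R := dprod E.

Definition supported (D : set I) : set U :=
  [set f | f \in @finsupp R I E /\ forall i, f i <> 0 -> D i].

Lemma supported_submodule D : submodule (supported D).
Proof.
split; first by split; [exact: rpred0|move=> i].
move=> r f g [ff fD] [fg gD]; split; first by rewrite rpredD ?rpredZ.
move=> i fgi; have [fi|/fD//] := pselect (f i = 0).
apply: gD => gi; apply: fgi.
by rewrite -[LHS]/(r *: f i + g i) fi gi scaler0 addr0.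
Qed.

Let partial_sum D := subm (supported_submodule D).

Definition restr (D : set I) (f : U) : U :=
  fun i => if `[< D i >] then f i else 0.

Lemma restr_linear D : linear (restr D).
Proof.
move=> r f g; apply: functional_extensionality_dep => i.
rewrite -[RHS]/(r *: restr D f i + restr D g i) /restr.
by case: ifP => // _; rewrite scaler0 addr0.
Qed.

Lemma restr_in D D' f :
  f \in partial_sum D' -> restr D f \in partial_sum (D `&` D').
Proof.
move=> /submP[/asboolP ff fD']; apply/submP; split.
  apply/asboolP; apply: sub_finite_set ff => i /=; rewrite /restr.
  by case: ifP.
by move=> i; rewrite /restr; case: asboolP => // Di /fD'.
Qed.

Lemma restr_id D f : f \in partial_sum D -> restr D f = f.
Proof.
move=> /submP[_ fD]; apply: functional_extensionality_dep => i.
rewrite /restr; case: asboolP => // nDi; apply/esym.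
by apply: contrapT => /fD.
Qed.

Lemma partial_sum_sub D D' :
  D `<=` D' -> {subset partial_sum D <= partial_sum D'}.
Proof. by move=> DD' f /submP[ff fD]; apply/submP; split=> // i /fD/DD'. Qed.

Lemma partial_sum_pure D D' :
  D `<=` D' -> pure_in [set` partial_sum D] [set` partial_sum D'].
Proof.
move=> DD'; apply: (pure_in_retract (q := restr D)).
- exact: submodule_mem.
- by move=> r f g _ _; apply: restr_linear.
- by move=> f /= /(restr_in D); apply: partial_sum_sub => i [].
- by move=> f; apply: restr_id.
Qed.

Lemma dsum_partial_sum :
  exists f : {linear dsum E -> submodT (partial_sum setT)}, bijective f.
Proof.
have [f fE] := @corestrict _ _ _ (partial_sum setT) (inclusion (@finsupp R I E))
  (fun x => introT submP (conj (valP x) (fun _ _ => Logic.I))).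
exists f; apply: inj_surj_bij.
  by move=> x y /(congr1 val); rewrite !fE => /val_inj.
move=> [x xS]; have /submP[xf _] := xS.
by exists (exist _ x xf); apply: val_inj; rewrite fE.
Qed.

Lemma K_partial_sum D : K (submodT (partial_sum D)).
Proof.
apply: (K_pure_sub (N := partial_sum setT));
  [exact: partial_sum_sub|exact: partial_sum_pure|].
have [f fbij] := dsum_partial_sum; apply: (K_iso (f := f)) => //.
by apply: Kdsum => i; have [] := injE i.
Qed.

Lemma inj_summand j : sub_injective (partial_sum [set j]).
Proof.
pose inc (x : E j) : U := fun i =>
  if pselect (j = i) is left e then ecast i (E i) e x else 0.
have incj x : inc x j = x.
  by rewrite /inc; case: pselect => // e; rewrite (Prop_irrelevance e erefl).
have inc_ne x i : j <> i -> inc x i = 0.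
  by rewrite /inc; case: pselect.
have lin : linear inc.
  move=> r x y; apply: functional_extensionality_dep => i.
  rewrite -[RHS]/(r *: inc x i + inc y i).
  have [<-|ji] := pselect (j = i); first by rewrite !incj.
  by rewrite !inc_ne// scaler0 addr0.
have incS x : mklin lin x \in partial_sum [set j].
  apply/submP; split.
    apply/asboolP; apply: (@sub_finite_set _ _ [set j]) => // i /= inci.
    by apply: contrapT => ij; apply: inci; apply: inc_ne => ji; apply: ij.
  move=> i inci; apply: contrapT => ij.
  by apply: inci; apply: inc_ne => ji; apply: ij.
have [p pE] := corestrict incS.
have evlin : linear (fun f : submodT (partial_sum [set j]) => val f j) by [].
apply: (rel_inj_retract (i := mklin evlin) (p := p)) (injE j).
move=> f; apply: val_inj; rewrite pE /=.
apply: functional_extensionality_dep => i.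
have [<-|ji] := pselect (j = i); first exact: incj.
rewrite inc_ne//; have /submP[_ fj] := valP f.
by apply/esym; apply: contrapT => /fj ij; apply: ji.
Qed.

Variable le : rel I.
Hypothesis wo : well_order le.

Let below i : set I := [set j | le j i /\ j <> i].

(** If [D] has a greatest element [m], the sum over [D] is that of the sum over
    the predecessors of [m] and of [E m]; if [D] is nonempty and has none, it is
    the union of the sums over the initial segments generated by the elements
    of [D]. *)
Lemma inj_partial_sum D : (forall i j, D i -> le j i -> D j) ->
  (forall i, D i -> sub_injective (partial_sum (below i))) ->
  sub_injective (partial_sum D).
Proof.
move=> Ddown IH.
have belowD i : D i -> below i `<=` D by move=> Di j [ji _]; apply: Ddown ji.
have [[i0 Di0]|D0] := pselect (exists i, D i); last first.
  apply/injP; split; first exact: K_partial_sum.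
  move=> B A KB As pA g glin gN.
  have lin : linear (fun _ : B => 0 : U).
    by move=> r x y; rewrite scaler0 addr0.
  exists (mklin lin) => [x|x /set_mem/gN/submP[_ gD]]; first exact: rpred0.
  apply: functional_extensionality_dep => i; apply/esym.
  by apply: contrapT => /gD Di; apply: D0; exists i.
have [[m Dm mmax]|nomax] := pselect (exists2 m, D m & forall i, D i -> le i m).
  have sE : D `<=` below m `|` [set m].
    move=> i Di; have [->|im] := pselect (i = m); first by right.
    by left; split=> //; apply: mmax.
  have mD : [set m] `<=` D by move=> _ ->.
  apply: (inj_sum (q := mklin (restr_linear (below m))) (K_partial_sum D)
    (IH m Dm) (inj_summand m)).
  - exact: partial_sum_sub (belowD m Dm).
  - exact: partial_sum_sub.
  - by move=> f /(restr_in (below m)); apply: partial_sum_sub => i [].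
  - move=> f fD.
    suff -> : f - restr (below m) f = restr [set m] f.
      by apply: partial_sum_sub (restr_in [set m] fD) => i [].
    apply: functional_extensionality_dep => i.
    rewrite -[LHS]/(f i - restr (below m) f i) /restr.
    have [Di|nDi] := pselect (D i); last first.
      have -> : f i = 0 by apply: contrapT => fi; have /submP[_ /(_ i fi)] := fD.
      by rewrite !if_same subrr.
    have [->|im] := pselect (i = m).
      by rewrite (asboolT (erefl : [set m] m)) asboolF ?subr0// => -[].
    rewrite (asboolF im : `[< [set m] i >] = false) asboolT ?subrr//.
    by split=> //; apply: mmax.
pose W : smallType := {i : I | D i}.
pose leW : rel W := fun v w => le (sval v) (sval w).
have limW : limit_order leW.
  split.
  - apply: antisymmetric_well_order.
      move=> [i Di] [j Dj] /andP[ij ji]; have e : i = j := wo_anti wo ij ji.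
      by case: _ / e Dj {ij ji} => Dj; congr exist; apply: Prop_irrelevance.
    move=> A [w wA].
    have [|m [v vA <-] mmin] :=
      wo_min wo (A := [set i | exists2 v, v \in A & sval v = i]).
      by exists (sval w), w.
    by exists v; split=> // u uA; apply: mmin; exists u.
  - by exists; exists i0.
  - move=> [i Di].
    have [j Dj ij] : exists2 j, D j & ~ le j i.
      apply: contrapT => nj; apply: nomax; exists i => // j Dj.
      by apply: contrapT => ji; apply: nj; exists j.
    exists (exist _ j Dj); first by case: (wo_total wo i j).
    by move=> [ji]; apply: ij; rewrite ji; apply: wo_refl.
have [|v w vw|S [SE injS _ _]] :=
  aec_chain aec (M := fun w : W => partial_sum (below (sval w))) limW.
- by move=> [i Di]; apply: IH.
- have vwb : below (sval v) `<=` below (sval w).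
    move=> i [iv niv]; split; first exact: wo_trans iv vw.
    by move=> iw; apply: niv; apply: (wo_anti wo iv); rewrite iw.
  by apply/le_subP; split; [exact: partial_sum_sub|exact: partial_sum_pure].
apply: sub_injective_eq injS => f; apply/idP/idP.
  by move=> /SE[[i Di] /=]; apply: partial_sum_sub; apply: belowD.
move=> fD; apply/SE.
have [m Dm mmax] : exists2 m, D m & forall i, f i <> 0 -> le i m.
  have /submP[/asboolP ff fD'] := fD.
  have /finite_seqP[s sE] : finite_set ([set i : {classic I} | f i <> 0]) by [].
  have [s0|s0] := pselect (s = [::]).
    exists i0 => // i fi; have : [set` s] i by rewrite -sE.
    by rewrite s0.
  have [m ms mmax] := @wo_max_seq {classic I} le s wo s0.
  have : [set` s] m by [].
  rewrite -sE => /fD' Dm; exists m => // i fi; apply: mmax.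
  by have : [set` s] i by rewrite -sE.
have [k Dk mk] : exists2 k, D k & ~ le k m.
  apply: contrapT => nj; apply: nomax; exists m => // j Dj.
  by apply: contrapT => ji; apply: nj; exists j.
have {}mk' : le m k by case: (wo_total wo m k).
exists (exist _ k Dk); apply/submP; have /submP[ff _] := fD; split=> // i fi /=.
split; first exact: wo_trans (mmax i fi) mk'.
by move=> ik; apply: mk; rewrite -ik; apply: mmax.
Qed.

Lemma inj_dsum : rel_injective K M (dsum E).
Proof.
have [f fbij] := dsum_partial_sum; have [g fK _] := linear_bij_inv fbij.
apply: (rel_inj_retract fK).
apply: inj_partial_sum => // i _.
elim/(wo_ind wo): i => i IH.
apply: inj_partial_sum => [k j [ki nki] jk|j [ji nji]]; last exact: IH.
split; first exact: wo_trans jk ki.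
by move=> ji; apply: nki; apply: (wo_anti wo ki); rewrite -ji.
Qed.

End DirectSum.

Lemma aec_noetherian :
  is_AEC (rel_injective K M) (le_sub M) -> noetherian K M.
Proof.
move=> aec I E injE.
have [le wo] := well_ordering_principle {classic I}.
exact: (@inj_dsum aec I E injE le wo).
Qed.

(** * The abstract elementary class of a noetherian pair *)

Lemma le_sub_iso (U V : lmodType R) (A B : submodClosed U)
    (A' B' : submodClosed V) (f : {linear submodT B -> submodT B'}) :
  {subset A <= B} -> {subset A' <= B'} -> bijective f ->
  (forall x, (val (f x) \in A') = (val x \in A)) ->
  pure_in [set` A] [set` B] -> pure_in [set` A'] [set` B'].
Proof.
move=> AB AB' /linear_bij_inv[g fK gK] fA pA m n r Sr a aA [b bB ba].
pose a1 i : submodT B' := exist _ (a i) (AB' _ (aA i)).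
pose b1 j : submodT B' := exist _ (b j) (bB j).
have ba1 : solves r b1 a1 by apply: solves_val.
have [||x xA xa] := pA _ _ _ Sr (fun i => val (g (a1 i))).
- by move=> i /=; rewrite -fA gK; apply: aA.
- exists (fun j => val (g (b1 j))); first by move=> j; apply: valP.
  exact: (solves_linear (inclusion B) (solves_linear g ba1)).
pose x1 j : submodT B := exist _ (x j) (AB _ (xA j)).
have xa1 : solves r x1 (g \o a1) by apply: solves_val.
exists (fun j => val (f (x1 j))) => [j|i]; first by rewrite /= fA; apply: xA.
have := solves_linear (inclusion B') (solves_linear f xa1) i.
by rewrite /= gK.
Qed.

Lemma noetherian_aec :
  noetherian K M -> is_AEC (rel_injective K M) (le_sub M).
Proof.
move=> noeth; split.
- by move=> U A B _ _ /le_subP[].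
- by move=> U A _; apply/le_subP; split=> //; apply: pure_in_refl.
- move=> U A B _ _ /le_subP[AB _] /le_subP[BA _] x.
  by apply/idP/idP => [/AB|/BA].
- move=> U A B C _ _ _ /le_subP[AB pA] /le_subP[BC pB]; apply/le_subP.
  split; first by move=> x /AB/BC.
  exact: pure_in_trans AB pA pB.
- by move=> A B f; apply: rel_inj_iso.
- move=> U V A B A' B' f _ _ AB AB' fbij fA /le_subP[_ pA]; apply/le_subP.
  by split=> //; apply: le_sub_iso fA pA.
- move=> U A B C _ _ _ AB /le_subP[_ pA] /le_subP[BC _]; apply/le_subP.
  by split=> //; apply: pure_in_sub BC pA.
- move=> U W le C [wo [w0] _] injC leC.
  have leC' i j : le i j -> {subset C i <= C j} /\ pure_in [set` C i] [set` C j].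
    by move=> /leC/le_subP.
  pose S := subm (chain_union_submodule (W := {classic W}) wo leC' setT).
  have CS i : {subset C i <= S} by move=> x xC; apply/submP; right; exists i.
  exists S; split.
  + move=> x; split; last by case=> i /CS.
    by move=> /submP[->|[i _ xC]]; [exists w0; exact: rpred0|exists i].
  + exact: (chain_union_inj (W := {classic W}) noeth wo injC leC' w0).
  + move=> i; apply/le_subP; split; first exact: CS.
    by rewrite subm_set; apply: (pure_chain_union (W := {classic W}) wo leC').
  + move=> N _ CN; apply/le_subP; split.
      move=> x /submP[->|[i _ xC]]; first exact: rpred0.
      by have /le_subP[CiN _] := CN i; apply: CiN.
    rewrite subm_set; apply: (chain_union_pure (W := {classic W}) wo leC').
      exact: submodule_mem.
    by move=> i _; have /le_subP[] := CN i.
- exists LST_bound; split.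
  + by apply: (@card_le_inj _ _ (fun n => inl (inl n))) => m n [].
  + by apply: (@card_le_inj _ _ (fun r => inl (inr r))) => r s [].
  move=> U N A injN AN.
  have [N0 [injN0 leN0 AN0 cN0]] := lowenheim_skolem noeth injN AN.
  by exists N0; split=> //; apply/le_subP.
Qed.

End Relative.

(** * The three classes of embeddings *)

Section ThreeClasses.
Variable R : pzRingType.

Lemma embedding_pure (A B : lmodType R) (f : {linear A -> B}) :
  embedding f <-> pure_map (fun _ _ _ => False) f.
Proof. by split=> [|[]//] f_inj; split. Qed.

Lemma pure_embedding_pure (A B : lmodType R) (f : {linear A -> B}) :
  pure_embedding f <-> pure_map (fun _ _ _ => True) f.
Proof.
split=> [] [f_inj pf]; split=> // m n r; last exact: (pf m n r I).
by move=> _; apply: pf.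
Qed.

Lemma rd_embedding_pure (A B : lmodType R) (f : {linear A -> B}) :
  rd_embedding f <-> pure_map (fun m n _ => m = 1%N /\ n = 1%N) f.
Proof.
split=> [] [f_inj pf]; split=> //.
  move=> m n r [m1 n1]; subst m n => a [b ba].
  have : (range f `&` range ( *:%R (r ord0 ord0) : B -> B)) (f (a ord0)).
    split; first by exists (a ord0).
    by exists (b ord0) => //; have := ba ord0; rewrite big_ord1.
  rewrite pf => -[_ [x _ <-] e].
  exists (fun=> x) => i; rewrite (ord1 i) big_ord1; apply: f_inj.
  by rewrite -e linearZ.
move=> r; apply/seteqP; split=> y; last first.
  move=> [_ [x _ <-] <-]; split; last by exists (f x).
  by exists (r *: x) => //; rewrite linearZ.
move=> [[a _ <-] [b _ e]].
have [|x xa] := pf 1%N 1%N (const_mx r) (conj erefl erefl) (fun=> a).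
  by exists (fun=> b) => i; rewrite big_ord1 mxE.
exists (f (x ord0)); first by exists (x ord0).
by have := xa ord0; rewrite big_ord1 mxE => <-; rewrite linearZ.
Qed.

End ThreeClasses.

Theorem theorem5p18 (R : pzRingType) (M : homClass R) (K : modClass R)
  (HM : M = @embedding R \/ M = @rd_embedding R \/ M = @pure_embedding R)
  (Kdsum : closed_dsum K) (Ksub : closed_sub K M) (Kepi : closed_epi K M) :
  noetherian K M <-> is_AEC (rel_injective K M) (le_sub M).
Proof.
have [Sig HSig] : exists Sig : forall m n, 'M[R]_(m, n) -> Prop,
    forall (A B : lmodType R) (f : {linear A -> B}), M A B f <-> pure_map Sig f.
  case: HM => [->|[->|->]]; eexists.
  - exact: embedding_pure.
  - exact: rd_embedding_pure.
  - exact: pure_embedding_pure.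
split; first exact: (noetherian_aec HSig).
exact: (aec_noetherian HSig).
Qed.
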